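(* Let $f:(\mathbb{C}^2,0)\to(\mathbb{C}^2,0)$ be a dominant semi-superattracting holomorphic germ. Then $f$ has a unique eigenvaluation $\nu_\star$, and $\nu_\star=\nu_C$ is a (possibly formal, i.e. possibly non-analytic) curve valuation with $m(C)=1$. Moreover exactly one of the following holds: (i) the only valuation fixed by $f_\bullet$ is $\nu_\star$, and there is exactly one contracted critical curve valuation $\nu_D$ for $f$, with $m(D)=1$; (ii) the set of valuations fixed by $f_\bullet$ consists of exactly two valuations, $\nu_\star$ and a curve valuation $\nu_D$, where $D$ is a (possibly formal) irreducible curve with $m(D)=1$. In both cases $C$ and $D$ intersect transversally, i.e. their intersection multiplicity is $C\cdot D=1$.
   Context: A dominant holomorphic germ $f:(\mathbb{C}^2,0)\to(\mathbb{C}^2,0)$ (i.e. $\det df$ not identically zero) is semi-superattracting if the eigenvalues of $df_0$ are $0$ and $\lambda$ with $\lambda\neq 0$. Valuative tree: let $R=\mathbb{C}[[x,y]]$ with maximal ideal $\mathfrak{m}$. A (centered, normalized) valuation is a map $\nu:R\to[0,+\infty]$ with $\nu(\phi\psi)=\nu(\phi)+\nu(\psi)$, $\nu(\phi+\psi)\ge\min\{\nu(\phi),\nu(\psi)\}$, $\nu(0)=+\infty$, $\nu(c)=0$ for $c\in\mathbb{C}^*$, and $\nu(\mathfrak{m}):=\min\{\nu(\phi):\phi\in\mathfrak{m}\}=1$. The set $\mathcal{V}$ of such valuations, ordered by $\nu\le\mu$ iff $\nu(\phi)\le\mu(\phi)$ for all $\phi$, is an $\mathbb{R}$-tree (the valuative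 tree of Favre–Jonsson) rooted at the multiplicity valuation $\nu_{\mathfrak m}(\phi)=\max\{n:\phi\in\mathfrak m^n\}$. For an irreducible formal curve germ $C=\{\psi=0\}$, $\psi\in\mathfrak m$ irreducible, with multiplicity $m(C)=\nu_{\mathfrak m}(\psi)$, the curve valuation is $\nu_C(\phi)=(C\cdot\{\phi=0\})/m(C)$, where $\cdot$ is the intersection multiplicity; it is analytic if $\psi$ may be taken convergent and formal/non-analytic otherwise. Curve valuations are ends (maximal elements) of $\mathcal V$. Action: write $f=(f_1,f_2)$ and $c(f,\nu)=\nu(f^*\mathfrak m)=\min\{\nu(f_1),\nu(f_2)\}$. A contracted critical curve valuation is $\nu_C$ with $C$ an irreducible curve germ such that $f(C)=\{0\}$ (equivalently $c(f,\nu_C)=\infty$); for other $\nu$ set $f_\bullet\nu(\phi)=\nu(\phi\circ f)/c(f,\nu)$, and for contracted critical curve valuations $f_\bullet\nu_C$ is defined as the limit of $f_\bullet\nu$ as $\nu$ increases to $\nu_C$ (it is a divisorial valuation). A fixed valuation is $\nu$ with $f_\bullet\nu=\nu$. An eigenvaluation is a fixed valuation $\nu_\star$ which is either quasimonomial (divisorial or irrational, i.e. a valuation that becomes monomial in suitable local coordinates at a point of some modification) or an end of $\mathcal V$ which is attracting, in the sense that there is $\nu_0<\nu_\star$ such that $f_\bullet$ maps the set $U=\{\nu\in\mathcal V:\nu\wedge\nu_\star>\nu_0\}$ strictly into itself and $f_\bullet^n\nu\to\nu_\star$ for all $\nu\in U$ ($\wedge$ denotes infimum in the tree). *)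

(* Defs.v *)
From HB Require Import structures.
From mathcomp Require Import all_boot all_order all_algebra.
From mathcomp Require Import all_classical all_reals all_analysis.
From mathcomp Require Import complex.
Set Implicit Arguments. Unset Strict Implicit. Unset Printing Implicit Defensive.
Import Order.TTheory GRing.Theory Num.Theory.
Local Open Scope ring_scope.
Local Open Scope classical_set_scope.

Section Defs.
Variable R : realType.
Local Notation C := R[i].

(* ---------- formal power series  C[[x,y]] : p i j = coeff of x^i y^j ---- *)
Definition ps := nat -> nat -> C.

Definition ps0 : ps := fun _ _ => 0.
Definition psC (c : C) : ps := fun i j => if (i == 0%N) && (j == 0%N) then c else 0.
Definition ps1 : ps := psC 1.
Definition psadd (p q : ps) : ps := fun i j => p i j + q i j.
Definition psmul (p q : ps) : ps := fun i j =>
  \sum_(k < i.+1) \sum_(l < j.+1) p k l * q (i - k)%N (j - l)%N.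
Definition pspow (p : ps) (n : nat) : ps := iter n (psmul p) ps1.

Definition in_max (p : ps) : Prop := p 0%N 0%N = 0.
Definition ps_unit (p : ps) : Prop := p 0%N 0%N != 0.

(* substitution phi(g1,g2), for g1, g2 in the maximal ideal
   (only finitely many terms contribute to each coefficient) *)
Definition pscomp (phi g1 g2 : ps) : ps := fun a b =>
  \sum_(k < (a + b).+1) \sum_(l < (a + b).+1)
     phi k l * psmul (pspow g1 k) (pspow g2 l) a b.

Definition divides (psi phi : ps) : Prop := exists q, phi = psmul psi q.

Definition ps_irreducible (psi : ps) : Prop :=
  in_max psi /\ psi <> ps0 /\
  forall a b, psi = psmul a b -> ps_unit a \/ ps_unit b.

(* multiplicity nu_m(phi) = max{n : phi in m^n} = least total degree of a
   nonzero monomial (+oo for phi = 0) *)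
Definition mult (phi : ps) : \bar R :=
  ereal_inf [set x | exists i j, phi i j != 0 /\ x = ((i + j)%:R)%:E].

(* intersection multiplicity  dim_C C[[x,y]]/(psi,phi)  (in [0,+oo]) *)
Definition in_ideal2 (psi phi chi : ps) : Prop :=
  exists a b, chi = psadd (psmul a psi) (psmul b phi).
Definition indep_mod (psi phi : ps) (n : nat) (chis : 'I_n -> ps) : Prop :=
  forall c : 'I_n -> C,
    in_ideal2 psi phi (fun i j => \sum_(k < n) c k * chis k i j) ->
    forall k, c k = 0.
Definition intmult (psi phi : ps) : \bar R :=
  ereal_sup [set x | exists n (chis : 'I_n -> ps),
                       indep_mod psi phi chis /\ x = (n%:R)%:E].

Definition curveval (psi : ps) : ps -> \bar R :=
  fun phi => (intmult psi phi * ((fine (mult psi))^-1)%:E)%E.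

Definition valuation (nu : ps -> \bar R) : Prop :=
  (forall phi, 0 <= nu phi)%E /\
  (forall p q, nu (psmul p q) = (nu p + nu q)%E) /\
  (forall p q, (Order.min (nu p) (nu q) <= nu (psadd p q))%E) /\
  nu ps0 = +oo%E /\
  (forall c, c != 0 -> nu (psC c) = 0%E) /\
  (forall phi, in_max phi -> (1 <= nu phi)%E) /\
  (exists phi, in_max phi /\ nu phi = 1%E).

Definition vle (nu mu : ps -> \bar R) : Prop := forall phi, (nu phi <= mu phi)%E.
Definition vlt (nu mu : ps -> \bar R) : Prop := vle nu mu /\ nu <> mu.

Definition is_inf (m nu mu : ps -> \bar R) : Prop :=
  valuation m /\ vle m nu /\ vle m mu /\
  forall w, valuation w -> vle w nu -> vle w mu -> vle w m.

Definition is_end (nu : ps -> \bar R) : Prop :=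
  valuation nu /\ forall mu, valuation mu -> vle nu mu -> mu = nu.

Definition germ := (ps * ps)%type.

Definition ccomp (phi : ps) (f : germ) : ps := pscomp phi f.1 f.2.

(* c(f,nu) = nu(f^* m) = min(nu f1, nu f2) *)
Definition cfn (f : germ) (nu : ps -> \bar R) : \bar R :=
  Order.min (nu f.1) (nu f.2).

Definition lim_up (nu : ps -> \bar R) (g : (ps -> \bar R) -> \bar R)
    (l : \bar R) : Prop :=
  forall U, nbhs l U -> exists nu0, valuation nu0 /\ vlt nu0 nu /\
    forall nu', valuation nu' -> vle nu0 nu' -> vlt nu' nu -> U (g nu').

(* push f nu mu  <->  f_bullet nu = mu *)
Definition push (f : germ) (nu mu : ps -> \bar R) : Prop :=
  valuation mu /\
  ((cfn f nu <> +oo%E /\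
     forall phi, mu phi = (nu (ccomp phi f) * ((fine (cfn f nu))^-1)%:E)%E)
   \/
   (cfn f nu = +oo%E /\
     forall phi, lim_up nu
       (fun nu' => (nu' (ccomp phi f) * ((fine (cfn f nu'))^-1)%:E)%E)
       (mu phi))).

Definition fixed (f : germ) (nu : ps -> \bar R) : Prop :=
  valuation nu /\ push f nu nu.

(* quasimonomial: monomial in suitable local coordinates at a point of a
   composition of point blow-ups.  Local charts of such modifications are
   the composites A0 o s o A1 o s o ... o s o Ak, with Ai formal changes of
   coordinates fixing 0 and s(z,w) = (z, z w). *)
Definition mapcomp (P Q : germ) : germ := (ccomp P.1 Q, ccomp P.2 Q).
Definition autom (A : germ) : Prop :=
  in_max A.1 /\ in_max A.2 /\
  A.1 1%N 0%N * A.2 0%N 1%N - A.1 0%N 1%N * A.2 1%N 0%N != 0.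
Definition blowup_chart : germ :=
  (fun i j => if (i == 1%N) && (j == 0%N) then 1 else 0,
   fun i j => if (i == 1%N) && (j == 1%N) then 1 else 0).
Inductive mod_chart : germ -> Prop :=
  | mod_chart_auto A : autom A -> mod_chart A
  | mod_chart_step P A : mod_chart P -> autom A ->
      mod_chart (mapcomp P (mapcomp blowup_chart A)).

Definition monoval (a b : R) (phi : ps) : \bar R :=
  ereal_inf [set x | exists i j, phi i j != 0 /\
                                 x = (a * i%:R + b * j%:R)%:E].

Definition quasimonomial (nu : ps -> \bar R) : Prop :=
  exists P a b, mod_chart P /\ 0 <= a /\ 0 <= b /\
    forall phi, nu phi = monoval a b (ccomp phi P).

Definition inU (nus nu0 nu : ps -> \bar R) : Prop :=
  valuation nu /\ exists m, is_inf m nu nus /\ vlt nu0 m.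

Definition attracting (f : germ) (nus : ps -> \bar R) : Prop :=
  exists nu0, valuation nu0 /\ vlt nu0 nus /\
    (forall nu, inU nus nu0 nu -> exists mu, push f nu mu) /\
    (forall nu mu, inU nus nu0 nu -> push f nu mu -> inU nus nu0 mu) /\
    (exists mu0, inU nus nu0 mu0 /\
                 forall nu, inU nus nu0 nu -> ~ push f nu mu0) /\
    (forall s : nat -> ps -> \bar R, inU nus nu0 (s 0%N) ->
       (forall n, push f (s n) (s n.+1)) ->
       forall phi, (fun n => s n phi) @ \oo --> nus phi).

Definition eigenvaluation (f : germ) (nus : ps -> \bar R) : Prop :=
  fixed f nus /\ (quasimonomial nus \/ (is_end nus /\ attracting f nus)).

(* contracted critical curve C = {psi = 0}: f(C) = {0} *)
Definition contracted (f : germ) (psi : ps) : Prop :=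
  ps_irreducible psi /\ divides psi f.1 /\ divides psi f.2.

Definition convergent (p : ps) : Prop :=
  exists r : R, 0 < r /\ exists M : R, forall N : nat,
    \sum_(i < N) \sum_(j < N) `|p i j| * (real_complex R r) ^+ (i + j)
      <= real_complex R M.

Definition holo_germ (f : germ) : Prop :=
  in_max f.1 /\ in_max f.2 /\ convergent f.1 /\ convergent f.2.

Definition psdx (p : ps) : ps := fun i j => (i.+1)%:R * p i.+1 j.
Definition psdy (p : ps) : ps := fun i j => (j.+1)%:R * p i j.+1.
Definition jacobian (f : germ) : ps :=
  psadd (psmul (psdx f.1) (psdy f.2))
        (fun i j => - psmul (psdy f.1) (psdx f.2) i j).
Definition dominant (f : germ) : Prop := jacobian f <> ps0.

Definition df0 (f : germ) : 'M[C]_2 :=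
  \matrix_(i < 2, j < 2)
    (if i == 0 :> nat then f.1 else f.2)
      (if j == 0 :> nat then 1%N else 0%N) (if j == 0 :> nat then 0%N else 1%N).

Definition semi_superattracting (f : germ) : Prop :=
  exists lam : C, lam != 0 /\
    forall z : C, eigenvalue (df0 f) z = (z == 0) || (z == lam).

Definition case_i (f : germ) (nus : ps -> \bar R) (D : ps) : Prop :=
  (forall nu, fixed f nu -> nu = nus) /\
  contracted f D /\ mult D = 1%E /\
  (forall psi, contracted f psi -> curveval psi = curveval D).

Definition case_ii (f : germ) (nus : ps -> \bar R) (D : ps) : Prop :=
  ps_irreducible D /\ mult D = 1%E /\
  fixed f (curveval D) /\ curveval D <> nus /\
  (forall nu, fixed f nu -> nu = nus \/ nu = curveval D).

End Defs.

(* Main.v *)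
(* In suitable formal coordinates (X, Y) the germ preserves both axes: graph
   transforms give a smooth invariant formal curve C = {Y = 0} tangent to the
   eigendirection of lambda, and one D = {X = 0} tangent to the kernel of df_0, so
   that X o f = X a with a a unit and Y o f = Y b with b in the maximal ideal.
   If f_* nu = nu and nu(X) < oo, evaluating at X gives c(f, nu) = 1, and then
   nu(Y) = nu(Y) + nu(b) with nu(b) >= 1 forces nu(Y) = oo, i.e. nu = nu_C; and
   nu(X) = oo means nu = nu_D. The valuations below nu_C are the monomial ones with
   nu(X) = 1 and nu(Y) = s >= 1, so a neighbourhood of nu_C is {nu(Y) > 1}: there
   c(f, nu) = 1 and nu(Y) grows by nu(b) >= 1 at each step, which makes nu_C
   attracting. On the other side nu(X) never increases, so nu_D does not attract.
   The two cases of the theorem are whether or not X divides b. *)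
Require Import Defs.
From HB Require Import structures.
From mathcomp Require Import all_boot all_order all_algebra.
From mathcomp Require Import all_classical all_reals all_analysis.
From mathcomp Require Import complex.
From mathcomp Require Import zify ring lra.
Set Implicit Arguments. Unset Strict Implicit. Unset Printing Implicit Defensive.
Import Order.TTheory GRing.Theory Num.Theory.
Local Open Scope ring_scope.
Local Open Scope classical_set_scope.

(** * Formal power series as a commutative ring *)

(** The invariant curves may diverge, so the coordinates are formal and every limit taken to build
    them is m-adic. In these coordinates f acts multiplicatively on X and Y, so a valuation turns
    the dynamics into additive relations between nu(X), nu(Y) and nu(b), with c(f, nu) = min(nu(X),
    nu(Y) + nu(b)). An infinite value on one axis determines nu: modulo Y every series is zero or a
    power of X times a unit, and likewise with X and Y exchanged. The dichotomy arises because X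
    divides b exactly when nu_D(b) is infinite. If it does, f^*m lies in the ideal of X, D is
    contracted, and the limit defining the image of nu_D takes the value 1 at X. If it does not,
    c(f, nu_D) = 1 + nu_D(b) is finite and the image still takes the value +oo at X, hence is nu_D.
    Quasimonomial valuations are finite on nonzero series, since pullback by a chart is injective;
    this rules out nu_D as a quasimonomial eigenvaluation. *)

Definition fps (R : realType) : Type := ps R.

Section Ring.
Variable R : realType.
Local Notation C := R[i].
Implicit Types p q r : fps R.

Lemma fpsP p q : (forall i j, p i j = q i j) -> p = q.
Proof. by move=> e; apply/funext => i; apply/funext => j. Qed.

(** A coefficient of a product depends on finitely many coefficients of the factors, so the ring
    laws are inherited from bivariate polynomials through truncation. *)
Definition agree n p (P : {poly {poly C}}) :=
  forall i j, (i < n)%N -> (j < n)%N -> p i j = P`_i`_j.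

Lemma agree_ex n p : exists P, agree n p P.
Proof.
exists (\poly_(i < n) \poly_(j < n) p i j) => i j lt_in lt_jn.
by rewrite coef_poly lt_in coef_poly lt_jn.
Qed.

Lemma agree_mul n p q P Q :
  agree n p P -> agree n q Q -> agree n (psmul p q) (P * Q).
Proof.
move=> pP qQ i j lt_in lt_jn; rewrite /psmul coefM coef_sum.
apply: eq_bigr => k _; rewrite coefM; apply: eq_bigr => l _.
by case: k l => k /= ltk [l /= ltl]; rewrite pP ?qQ //; lia.
Qed.

Lemma agree_inj p q :
  (forall n, exists P, agree n p P /\ agree n q P) -> p = q.
Proof.
move=> h; apply: fpsP => i j.
have [P [pP qP]] := h (maxn i j).+1.
by rewrite pP ?qP //; lia.
Qed.

Lemma psmulA (p q r : fps R) : psmul p (psmul q r) = psmul (psmul p q) r.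
Proof.
apply: agree_inj => n; have [P pP] := agree_ex n p.
have [Q qQ] := agree_ex n q; have [T rT] := agree_ex n r.
exists (P * (Q * T)); split; last rewrite mulrA; by do 2?apply: agree_mul.
Qed.

Lemma psmulC (p q : fps R) : psmul p q = psmul q p.
Proof.
apply: agree_inj => n; have [P pP] := agree_ex n p.
have [Q qQ] := agree_ex n q.
by exists (P * Q); split; last rewrite mulrC; apply: agree_mul.
Qed.

Lemma psmulDl (p q r : fps R) :
  psmul (psadd p q) r = psadd (psmul p r) (psmul q r).
Proof.
apply: fpsP => i j; rewrite /psadd /psmul -big_split; apply: eq_bigr => k _.
by rewrite -big_split; apply: eq_bigr => l _; rewrite mulrDl.
Qed.

Lemma psCmulE c (p : fps R) i j : psmul (psC c) p i j = c * p i j.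
Proof.
rewrite /psmul big_ord_recl big_ord_recl /= !subn0 /psC /=.
rewrite big1 ?addr0 => [|l _]; last by rewrite mul0r.
by rewrite big1 ?addr0 // => k _; rewrite big1 // => l _; rewrite mul0r.
Qed.

Lemma ps1mul (p : fps R) : psmul (ps1 R) p = p.
Proof. by apply: fpsP => i j; rewrite psCmulE mul1r. Qed.

HB.instance Definition _ := gen_eqMixin (fps R).
HB.instance Definition _ := gen_choiceMixin (fps R).

Fact fps_addA : associative (@psadd R : fps R -> fps R -> fps R).
Proof. by move=> p q r; apply: fpsP => i j; apply: addrA. Qed.
Fact fps_addC : commutative (@psadd R : fps R -> fps R -> fps R).
Proof. by move=> p q; apply: fpsP => i j; apply: addrC. Qed.
Fact fps_add0 : left_id (ps0 R : fps R) (@psadd R).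
Proof. by move=> p; apply: fpsP => i j; apply: add0r. Qed.
Fact fps_addN :
  left_inverse (ps0 R : fps R) (fun p i j => - p i j) (@psadd R).
Proof. by move=> p; apply: fpsP => i j; apply: addNr. Qed.

HB.instance Definition _ :=
  GRing.isZmodule.Build (fps R) fps_addA fps_addC fps_add0 fps_addN.

Fact fps_1_neq0 : (ps1 R : fps R) != 0.
Proof.
apply/eqP => /(congr1 (fun p : fps R => p 0%N 0%N)) /eqP.
by rewrite /ps1 /psC /= oner_eq0.
Qed.

HB.instance Definition _ := GRing.Zmodule_isComNzRing.Build (fps R)
  psmulA psmulC ps1mul psmulDl fps_1_neq0.

Lemma fpsDE p q i j : (p + q) i j = p i j + q i j. Proof. by []. Qed.
Lemma fpsNE p i j : (- p) i j = - p i j. Proof. by []. Qed.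
Lemma fpsBE p q i j : (p - q) i j = p i j - q i j. Proof. by []. Qed.
Lemma fps0E i j : (0 : fps R) i j = 0. Proof. by []. Qed.
Lemma fpsME p q i j :
  (p * q) i j = \sum_(k < i.+1) \sum_(l < j.+1) p k l * q (i - k)%N (j - l)%N.
Proof. by []. Qed.
Lemma fps_sumE I (s : seq I) (P : pred I) (F : I -> fps R) i j :
  (\sum_(k <- s | P k) F k) i j = \sum_(k <- s | P k) F k i j.
Proof. by elim/big_rec2: _ => // k x y _ <-. Qed.

Definition cst (c : C) : fps R := psC c.

Lemma cstME c p i j : (cst c * p) i j = c * p i j.
Proof. exact: psCmulE. Qed.
Lemma cst0 : cst 0 = 0.
Proof. by apply: fpsP => i j; rewrite /cst /psC if_same. Qed.
Lemma cst1 : cst 1 = 1. Proof. by []. Qed.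
Lemma cstM a b : cst (a * b) = cst a * cst b.
Proof.
by apply: fpsP => i j; rewrite cstME /cst /psC; case: ifP => _; rewrite ?mulr0.
Qed.
Definition x_ : fps R := fun i j => ((i == 1%N) && (j == 0%N))%:R.
Definition y_ : fps R := fun i j => ((i == 0%N) && (j == 1%N))%:R.

Lemma xME p i j : (x_ * p) i j = if i is i'.+1 then p i' j else 0.
Proof.
rewrite fpsME; case: i => [|i].
  by rewrite big1 // => k _; rewrite big1 // => l _; rewrite ord1 mul0r.
rewrite big_ord_recl big1 ?add0r => [|l _]; last by rewrite mul0r.
rewrite big_ord_recl [X in _ + X]big1 ?addr0 => [|k _]; last first.
  by rewrite big1 // => l _; rewrite mul0r.
rewrite big_ord_recl big1 ?addr0 => [|l _]; last by rewrite mul0r.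
by rewrite /= mul1r subn0 subSS subn0.
Qed.

Lemma yME p i j : (y_ * p) i j = if j is j'.+1 then p i j' else 0.
Proof.
rewrite fpsME big_ord_recl [X in _ + X]big1 ?addr0 => [|k _]; last first.
  by rewrite big1 // => l _; rewrite mul0r.
case: j => [|j]; first by rewrite big1 // => k _; rewrite ord1 mul0r.
rewrite big_ord_recl big_ord_recl big1 ?addr0 => [|l _]; last by rewrite mul0r.
by rewrite /= mul0r add0r mul1r !subn0 subSS subn0.
Qed.

(* Every series is p(0,0) + x * divx p + y * divy p: to make the splitting
   unique, monomials divisible by x go to divx and divy p involves no x. *)
Definition divx p : fps R := fun i j => p i.+1 j.
Definition divy p : fps R := fun i j => if i == 0%N then p 0%N j.+1 else 0.

Lemma fps_split p : p = cst (p 0%N 0%N) + x_ * divx p + y_ * divy p.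
Proof.
apply: fpsP => -[|i] [|j]; rewrite !fpsDE xME yME /cst /psC /= ?addr0 ?add0r //.
Qed.

Definition inm (n : nat) p : Prop := forall i j, (i + j < n)%N -> p i j = 0.

Lemma inm0 n : inm n 0. Proof. by []. Qed.
Lemma inmD n p q : inm n p -> inm n q -> inm n (p + q).
Proof. by move=> hp hq i j lt; rewrite fpsDE hp // hq // addr0. Qed.
Lemma inmN n p : inm n p -> inm n (- p).
Proof. by move=> hp i j lt; rewrite fpsNE hp // oppr0. Qed.
Lemma inmB n p q : inm n p -> inm n q -> inm n (p - q).
Proof. by move=> hp hq; apply/inmD/inmN. Qed.
Lemma inmW m n p : (m <= n)%N -> inm n p -> inm m p.
Proof. by move=> le hp i j lt; apply: hp; apply: leq_trans le. Qed.
Lemma inmM m n p q : inm m p -> inm n q -> inm (m + n) (p * q).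
Proof.
move=> hp hq i j lt; rewrite fpsME big1 // => k _; rewrite big1 // => l _.
have [ltm|gem] := ltnP (k + l) m; first by rewrite hp ?mul0r.
by rewrite hq ?mulr0 //; case: k l gem => k /= ltk [l /= ltl]; lia.
Qed.
Lemma inmMl n p q : inm n q -> inm n (p * q).
Proof. by move=> hq; rewrite -[n]add0n; apply: inmM. Qed.
Lemma inmX m n p : inm m p -> inm (m * n) (p ^+ n).
Proof.
move=> hp; elim: n => [|n IHn]; first by rewrite muln0.
by rewrite exprS mulnS; apply: inmM.
Qed.
Lemma inm_eq0 p : (forall n, inm n p) -> p = 0.
Proof. by move=> h; apply: fpsP => i j; apply: (h (i + j).+1). Qed.
Lemma inm1P p : inm 1 p <-> in_max p.
Proof. by split=> [h|h [|i] [|j] //]; apply: h. Qed.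

Lemma inm_x : inm 1 x_. Proof. by case=> [|i] [|j]. Qed.
Lemma inm_y : inm 1 y_. Proof. by case=> [|i] [|j]. Qed.

(* The operator d vanishes if d p lies in m^n as soon as all the values of d do
   in m^(n-1): this replaces induction on monomials. *)
Lemma inm_coind (d D1 D2 : fps R -> fps R) (a b : fps R) : inm 1 a -> inm 1 b ->
  (forall p, d p = a * d (D1 p) + b * d (D2 p)) -> forall p, d p = 0.
Proof.
move=> ha hb hd p; apply: inm_eq0 => n; elim: n p => [|n IHn] p //.
by rewrite hd -add1n; apply: inmD; apply: inmM.
Qed.

Lemma fps_00M p q : (p * q) 0%N 0%N = p 0%N 0%N * q 0%N 0%N.
Proof. by rewrite fpsME !big_ord1. Qed.
Lemma fps_10M p q :
  (p * q) 1%N 0%N = p 0%N 0%N * q 1%N 0%N + p 1%N 0%N * q 0%N 0%N.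
Proof. by rewrite fpsME big_ord_recl !big_ord1. Qed.
Lemma fps_01M p q :
  (p * q) 0%N 1%N = p 0%N 0%N * q 0%N 1%N + p 0%N 1%N * q 0%N 0%N.
Proof. by rewrite fpsME big_ord1 big_ord_recl big_ord1. Qed.

Lemma pspowE p n : pspow p n = p ^+ n :> fps R.
Proof. by elim: n => // n IHn; rewrite exprS -IHn. Qed.

End Ring.

(** * Substitution and formal coordinate changes *)

Section Composition.
Variable R : realType.
Local Notation C := R[i].
Implicit Types (p q r : fps R) (f g h : germ R).

Definition comp f p : fps R := ccomp p f.
Local Notation "p ∘ f" := (comp f p) (at level 35, right associativity).
Local Notation x := (x_ R).
Local Notation y := (y_ R).

(* Components of a germ, retyped so that the ring operations apply. *)
Definition fst_ f : fps R := f.1.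
Definition snd_ f : fps R := f.2.
Definition centered f := inm 1 (fst_ f) /\ inm 1 (snd_ f).

Definition tcomp f n m p : fps R :=
  \sum_(k < n) \sum_(l < m) cst (p k l) * (fst_ f ^+ k * snd_ f ^+ l).

(** In [pscomp] the summation range moves with the coefficient. Modulo m^N any large enough fixed
    rectangle of exponents gives the same result, because f_1^k f_2^l lies in m^(k+l). *)
Lemma comp_tcomp f p N n m : centered f -> (N <= n)%N -> (N <= m)%N ->
  inm N (p ∘ f - tcomp f n m p).
Proof.
move=> [h1 h2] leNn leNm i j lt; apply/eqP; rewrite fpsBE subr_eq0; apply/eqP.
have ltn : (i + j < n)%N by lia.
have ltm : (i + j < m)%N by lia.
have van k l : (i + j < k + l)%N -> (fst_ f ^+ k * snd_ f ^+ l) i j = 0.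
  by move=> ltkl; move: (inmM (inmX (n := k) h1) (inmX (n := l) h2)) => /(_ i j); apply; lia.
pose F k l := p k l * (fst_ f ^+ k * snd_ f ^+ l) i j.
have -> : (p ∘ f) i j = \sum_(k < (i + j).+1) \sum_(l < (i + j).+1) F k l.
  by apply: eq_bigr => k _; apply: eq_bigr => l _; rewrite !pspowE.
have -> : tcomp f n m p i j = \sum_(k < n) \sum_(l < m) F k l.
  rewrite /tcomp fps_sumE; apply: eq_bigr => k _.
  by rewrite fps_sumE; apply: eq_bigr => l _; rewrite cstME.
have in_eq k : \sum_(l < (i + j).+1) F k l = \sum_(l < m) F k l.
  rewrite (big_ord_widen _ (F k) ltm) [RHS](bigID (fun l : 'I_m => (l < (i + j).+1)%N)).
  rewrite /= [X in _ = _ + X]big1 ?addr0 // => l; rewrite -leqNgt => gel.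
  by rewrite /F van ?mulr0 //; lia.
under eq_bigr => k _ do rewrite (in_eq k).
rewrite (big_ord_widen _ (fun k => \sum_(l < m) F k l) ltn).
rewrite [RHS](bigID (fun l : 'I_n => (l < (i + j).+1)%N)) /=.
rewrite [X in _ = _ + X]big1 ?addr0 // => k; rewrite -leqNgt => gek.
by rewrite big1 // => l _; rewrite /F van ?mulr0 //; lia.
Qed.

Lemma compD f p q : (p + q) ∘ f = p ∘ f + q ∘ f.
Proof.
apply: fpsP => i j; rewrite fpsDE /comp /ccomp /pscomp -big_split.
apply: eq_bigr => k _; rewrite -big_split; apply: eq_bigr => l _.
by rewrite fpsDE mulrDl.
Qed.

Lemma comp0 f : 0 ∘ f = 0.
Proof. by apply: (addIr (0 ∘ f)); rewrite -compD !add0r. Qed.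

Lemma compN f p : (- p) ∘ f = - (p ∘ f).
Proof. by apply: (addIr (p ∘ f)); rewrite -compD !addNr comp0. Qed.

Lemma compB f p q : (p - q) ∘ f = p ∘ f - q ∘ f.
Proof. by rewrite compD compN. Qed.

Lemma comp_cst f c : cst c ∘ f = cst c.
Proof.
apply: fpsP => i j; rewrite /comp /ccomp /pscomp big_ord_recl big_ord_recl.
rewrite [X in _ + X]big1 ?addr0 => [|k _]; last first.
  by rewrite big1 // => l _; rewrite /cst /psC /= mul0r.
rewrite big1 ?addr0 => [|l _]; last by rewrite /cst /psC /= mul0r.
rewrite /cst {1}/psC /= /pspow /= (_ : psmul _ _ = (1 * 1 : fps R)) // mulr1.
by rewrite /GRing.one /= /ps1 /psC; case: ifP; rewrite ?mulr0 ?mulr1.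
Qed.

Lemma comp1 f : 1 ∘ f = 1. Proof. exact: comp_cst. Qed.

Lemma comp_x f p : centered f -> (x * p) ∘ f = fst_ f * (p ∘ f).
Proof.
move=> cf; apply/eqP; rewrite -subr_eq0; apply/eqP; apply: inm_eq0 => n.
(* Multiplication by x shifts the first exponent, so a range longer by one makes the two truncated
   sums equal term by term. *)
have e : tcomp f n.+1 n (x * p) = fst_ f * tcomp f n n p.
  rewrite /tcomp big_ord_recl /= big1 ?add0r => [|l _]; last first.
    by rewrite xME cst0 mul0r.
  rewrite mulr_sumr; apply: eq_bigr => k _; rewrite mulr_sumr.
  by apply: eq_bigr => l _; rewrite xME /= /bump add1n exprS -mulrA mulrCA.
have -> : (x * p) ∘ f - fst_ f * (p ∘ f) = ((x * p) ∘ f - tcomp f n.+1 n (x * p))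
   - fst_ f * (p ∘ f - tcomp f n n p) by rewrite e; ring.
by apply: inmB; [|apply: inmMl]; apply: comp_tcomp.
Qed.

Lemma comp_y f p : centered f -> (y * p) ∘ f = snd_ f * (p ∘ f).
Proof.
move=> cf; apply/eqP; rewrite -subr_eq0; apply/eqP; apply: inm_eq0 => n.
have e : tcomp f n n.+1 (y * p) = snd_ f * tcomp f n n p.
  rewrite /tcomp mulr_sumr; apply: eq_bigr => k _.
  rewrite big_ord_recl /= yME cst0 mul0r add0r mulr_sumr.
  by apply: eq_bigr => l _; rewrite yME /= /bump add1n exprS; ring.
have -> : (y * p) ∘ f - snd_ f * (p ∘ f) = ((y * p) ∘ f - tcomp f n n.+1 (y * p))
   - snd_ f * (p ∘ f - tcomp f n n p) by rewrite e; ring.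
by apply: inmB; [|apply: inmMl]; apply: comp_tcomp.
Qed.

Lemma comp_split f p : centered f ->
  p ∘ f = cst (p 0%N 0%N) + fst_ f * (divx p ∘ f) + snd_ f * (divy p ∘ f).
Proof.
by move=> cf; rewrite {1}[p]fps_split !compD comp_cst comp_x // comp_y.
Qed.

Lemma compM f p q : centered f -> (p * q) ∘ f = (p ∘ f) * (q ∘ f).
Proof.
move=> cf; apply/eqP; rewrite -subr_eq0; apply/eqP; move: p.
apply: (inm_coind (D1 := @divx R) (D2 := @divy R) cf.1 cf.2) => p.
rewrite {1}[p]fps_split !mulrDl !compD -!mulrA comp_x // comp_y //.
rewrite [p ∘ f]comp_split //.
suff -> : (cst (p 0%N 0%N) * q) ∘ f = cst (p 0%N 0%N) * (q ∘ f) by ring.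
apply: fpsP => i j; rewrite cstME /comp /ccomp /pscomp mulr_sumr.
apply: eq_bigr => k _; rewrite mulr_sumr; apply: eq_bigr => l _.
by rewrite cstME mulrA.
Qed.

Lemma compX f : centered f -> x ∘ f = fst_ f.
Proof. by move=> cf; rewrite -[x]mulr1 comp_x // comp1 mulr1. Qed.
Lemma compY f : centered f -> y ∘ f = snd_ f.
Proof. by move=> cf; rewrite -[y]mulr1 comp_y // comp1 mulr1. Qed.

Lemma inm_comp f n p : centered f -> inm n p -> inm n (p ∘ f).
Proof.
move=> cf; elim: n p => [|n IHn] p hp; first by [].
have p0 : p 0%N 0%N = 0 by apply: hp.
rewrite comp_split // p0 cst0 add0r -add1n; apply: inmD; apply: inmM.
- exact: cf.1.
- by apply: IHn => i j lt; rewrite /divx hp.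
- exact: cf.2.
- by apply: IHn => i j lt; rewrite /divy; case: i lt => // lt; rewrite hp.
Qed.

Definition gcomp f g : germ R := (fst_ f ∘ g, snd_ f ∘ g).

Lemma centered_gcomp f g : centered f -> centered g -> centered (gcomp f g).
Proof. by move=> [f1 f2] cg; split; apply: inm_comp. Qed.

Lemma compA f g p : centered f -> centered g -> (p ∘ f) ∘ g = p ∘ gcomp f g.
Proof.
move=> cf cg; apply/eqP; rewrite -subr_eq0; apply/eqP; move: p.
have [c1 c2] := centered_gcomp cf cg; apply: (inm_coind (D1 := @divx R) (D2 := @divy R) c1 c2) => p.
rewrite (comp_split _ cf) (comp_split _ (centered_gcomp cf cg)).
by rewrite !compD !compM // comp_cst /gcomp /fst_ /snd_ /=; ring.
Qed.

Definition id_ : germ R := (x, y).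
Lemma centered_id : centered id_.
Proof. by split; [apply: inm_x|apply: inm_y]. Qed.

Lemma comp_id p : p ∘ id_ = p.
Proof.
apply/eqP; rewrite -subr_eq0; apply/eqP; move: p.
apply: (inm_coind (D1 := @divx R) (D2 := @divy R) centered_id.1 centered_id.2) => p.
transitivity (p ∘ id_ - (cst (p 0%N 0%N) + x * divx p + y * divy p)).
  by rewrite -fps_split.
by rewrite (comp_split _ centered_id) /fst_ /snd_ /=; ring.
Qed.

Lemma inm_divx n p : inm n p -> inm n.-1 (divx p).
Proof. by move=> hp i j lt; apply: hp; lia. Qed.
Lemma inm_divy n p : inm n p -> inm n.-1 (divy p).
Proof. by move=> hp i j lt; rewrite /divy; case: eqP => // i0; apply: hp; lia. Qed.

(** A mean-value estimate: each monomial of p has degree at least k, and in the difference one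
    factor is replaced by an element of m^n while the other k - 1 stay in m. *)
Lemma inm_comp_sub f g n k p : centered f -> centered g ->
  inm n (fst_ f - fst_ g) -> inm n (snd_ f - snd_ g) -> inm k p ->
  inm (n + k).-1 (p ∘ f - p ∘ g).
Proof.
move=> cf cg h1 h2 hp.
(* Splitting p produces differences of the same kind again, multiplied by an element of m. The cap N
   makes this a terminating induction: each round gains one order until the target is reached. *)
suff main N : inm (minn N (n + k).-1) (p ∘ f - p ∘ g).
  by apply: inmW (main (n + k)); lia.
elim: N k p hp => [|N IHN] k p hp; first by rewrite min0n.
have -> : p ∘ f - p ∘ g = ((fst_ f - fst_ g) * (divx p ∘ f)
    + fst_ g * (divx p ∘ f - divx p ∘ g)) + ((snd_ f - snd_ g) * (divy p ∘ f)
    + snd_ g * (divy p ∘ f - divy p ∘ g)).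
  by rewrite (comp_split _ cf) (comp_split _ cg); ring.
have hx := inm_divx hp; have hy := inm_divy hp.
apply: inmD; apply: inmD.
- by apply: inmW (inmM h1 (inm_comp cf hx)); lia.
- by apply: inmW (inmM cg.1 (IHN _ _ hx)); lia.
- by apply: inmW (inmM h2 (inm_comp cf hy)); lia.
- by apply: inmW (inmM cg.2 (IHN _ _ hy)); lia.
Qed.

(* Substitutes u = 1 - p / p(0,0) in the geometric series. *)
Lemma inv_ex p : p 0%N 0%N != 0 -> exists q, p * q = 1.
Proof.
move=> p0; pose u := 1 - cst (p 0%N 0%N)^-1 * p.
pose geo : fps R := fun i j => (j == 0%N)%:R.
have hu : inm 1 u.
  by case=> [|i] [|j] // _; rewrite /u fpsBE cstME mulVf // subrr.
have cf : centered (u, 0) by split; [|apply: inm0].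
have : geo = 1 + x * geo.
  by apply: fpsP => -[|i] [|j]; rewrite fpsDE xME /GRing.one /= /ps1 /psC /geo /= ?addr0 ?add0r.
move=> /(congr1 (comp (u, 0))); rewrite compD comp1 comp_x // /fst_ /= => e.
exists (cst (p 0%N 0%N)^-1 * (geo ∘ (u, 0))); rewrite mulrCA mulrA.
have -> : cst (p 0%N 0%N)^-1 * p = 1 - u by rewrite /u; ring.
by rewrite mulrBl mul1r {1}e; ring.
Qed.

Lemma comp_00 f p : centered f -> (p ∘ f) 0%N 0%N = p 0%N 0%N.
Proof.
move=> cf; rewrite comp_split // !fpsDE !fps_00M.
by rewrite cf.1 // cf.2 // !mul0r !addr0.
Qed.
Lemma comp_10 f p : centered f -> (p ∘ f) 1%N 0%N =
  p 1%N 0%N * fst_ f 1%N 0%N + p 0%N 1%N * snd_ f 1%N 0%N.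
Proof.
move=> cf; rewrite comp_split // !fpsDE !fps_10M !comp_00 //.
by rewrite cf.1 // cf.2 // /cst /psC /divx /divy /=; ring.
Qed.
Lemma comp_01 f p : centered f -> (p ∘ f) 0%N 1%N =
  p 1%N 0%N * fst_ f 0%N 1%N + p 0%N 1%N * snd_ f 0%N 1%N.
Proof.
move=> cf; rewrite comp_split // !fpsDE !fps_01M !comp_00 //.
by rewrite cf.1 // cf.2 // /cst /psC /divx /divy /=; ring.
Qed.

(** * Formal coordinate changes and their inverses *)

Lemma gcompA f g h : centered g -> centered h ->
  gcomp (gcomp f g) h = gcomp f (gcomp g h).
Proof. by move=> cg ch; rewrite /gcomp /fst_ /snd_ /= !compA. Qed.
Lemma gcomp_id f : gcomp f id_ = f.
Proof. by rewrite /gcomp !comp_id; case: f. Qed.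
Lemma gcomp_idl f : centered f -> gcomp id_ f = f.
Proof.
by move=> cf; rewrite /gcomp /id_ /fst_ /snd_ /= compX ?compY //; case: f cf.
Qed.

Lemma autom_centered f : autom f -> centered f.
Proof. by move=> [/inm1P h1 [/inm1P h2 _]]. Qed.

Definition det f : C :=
  fst_ f 1%N 0%N * snd_ f 0%N 1%N - fst_ f 0%N 1%N * snd_ f 1%N 0%N.

Lemma automE f : autom f <-> centered f /\ det f != 0.
Proof.
split=> [af|[[/inm1P h1 /inm1P h2] d]]; last by [].
by split; [apply: autom_centered|case: af => _ []].
Qed.

Lemma det_gcomp f g : centered g -> det (gcomp f g) = det f * det g.
Proof. move=> cg; rewrite /det /gcomp /fst_ /snd_ /= !comp_10 // !comp_01 //.
by rewrite /fst_ /snd_; ring. Qed.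

Lemma autom_gcomp f g : autom f -> autom g -> autom (gcomp f g).
Proof.
move=> /automE[cf df] /automE[cg dg]; apply/automE; split.
  exact: centered_gcomp.
by rewrite det_gcomp // mulf_neq0.
Qed.

(** Coefficientwise solution of E p = p(0,0) + x E(D1 p) + y E(D2 p). The counter [n] is meant to be
    the total degree i + j, which drops by one at each unfolding. *)
Fixpoint expand_coef (D1 D2 : fps R -> fps R) n p i j : C :=
  if n is n'.+1 then (if i is i'.+1 then expand_coef D1 D2 n' (D1 p) i' j else 0)
    + (if j is j'.+1 then expand_coef D1 D2 n' (D2 p) i j' else 0)
  else p 0%N 0%N.

Lemma expand_ex (D1 D2 : fps R -> fps R) : exists E : fps R -> fps R,
  forall p, E p = cst (p 0%N 0%N) + x * E (D1 p) + y * E (D2 p).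
Proof.
exists (fun p i j => expand_coef D1 D2 (i + j) p i j) => p.
apply: fpsP => i j; rewrite !fpsDE xME yME /cst /psC.
by case: i j => [|i] [|j] //=; rewrite ?addr0 // ?add0r // ?addn0 ?addnS ?addSn ?addr0.
Qed.

(** Every series is expanded in powers of the components of f. Writing f_1 = x a + y b and f_2 = x c
    + y d with ad - bc a unit, Cramer's rule gives p = p(0,0) + f_1 D1 p + f_2 D2 p; iterating this
    yields E with (E p) ∘ f = p, and the inverse is (E x, E y). *)
Lemma autom_surj f : autom f ->
  exists g, centered g /\ gcomp g f = id_.
Proof.
move=> /automE[cf df].
pose a := divx (fst_ f); pose b := divy (fst_ f).
pose c := divx (snd_ f); pose d := divy (snd_ f).
have [u eu] : exists u, (a * d - b * c) * u = 1.
  by apply: inv_ex; rewrite fpsBE !fps_00M.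
have ef : fst_ f = x * a + y * b.
  by rewrite [LHS]fps_split cf.1 // cst0 add0r.
have es : snd_ f = x * c + y * d.
  by rewrite [LHS]fps_split cf.2 // cst0 add0r.
pose D1 p := u * (d * divx p - c * divy p).
pose D2 p := u * (a * divy p - b * divx p).
have [E hE] := expand_ex D1 D2.
have EK p : E p ∘ f = p.
  apply/eqP; rewrite eq_sym -subr_eq0; apply/eqP; move: p.
  apply: (inm_coind (D1 := D1) (D2 := D2) cf.1 cf.2) => p.
  transitivity (cst (p 0%N 0%N) + x * divx p + y * divy p - (E p ∘ f)).
    by rewrite -fps_split.
  rewrite (hE p) !compD comp_cst comp_x // comp_y //.
  rewrite [_ * (D1 p - _)]mulrBr [_ * (D2 p - _)]mulrBr.
  suff e : x * divx p + y * divy p = fst_ f * D1 p + snd_ f * D2 p.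
    by rewrite -[_ + y * divy p]addrA e; ring.
  transitivity (((a * d - b * c) * u) * (x * divx p + y * divy p)).
    by rewrite eu mul1r.
  by rewrite ef es /D1 /D2; ring.
have E00 p : p 0%N 0%N = 0 -> inm 1 (E p).
  by move=> p0; apply/inm1P; rewrite /in_max -(comp_00 _ cf) EK.
exists (E x, E y); split; first by split; apply: E00.
by rewrite /gcomp /fst_ /snd_ /= !EK.
Qed.

Lemma autom_inv f : autom f ->
  exists g, autom g /\ gcomp g f = id_ /\ gcomp f g = id_.
Proof.
move=> af; have cf := autom_centered af; have [g [cg gK]] := autom_surj af.
have ag : autom g.
  apply/automE; split=> //; apply/eqP => d0; have := det_gcomp g cf.
  rewrite gK d0 mul0r /det /id_ /fst_ /snd_ /= => /eqP.
  by rewrite /x_ /y_ /= mulr1 mulr0 subr0 oner_eq0.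
(* The left inverse g has a left inverse h of its own, and associativity identifies h with f. *)
exists g; split=> //; split=> //; have [h [ch hK]] := autom_surj ag.
suff <- : h = f by [].
by rewrite -[h]gcomp_id -gK -gcompA // hK gcomp_idl.
Qed.

End Composition.

Local Notation "p ∘ f" := (comp f p) (at level 35, right associativity).

(** * Invariant curves *)

Section InvariantCurves.
Variable R : realType.
Local Notation C := R[i].
Implicit Types (p q r phi theta : fps R) (f g h : germ R).
Local Notation x := (x_ R).
Local Notation y := (y_ R).
Local Notation id_ := (id_ R).

Lemma centered_pair (a b : fps R) : inm 1 a -> inm 1 b -> centered (a, b).
Proof. by []. Qed.

Lemma comp_pairA p (a b : fps R) g : inm 1 a -> inm 1 b -> centered g ->
  (p ∘ (a, b)) ∘ g = p ∘ (a ∘ g, b ∘ g).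
Proof. by move=> ha hb cg; rewrite compA. Qed.

Lemma comp_x0E p i j : (p ∘ (x, 0)) i j = if j == 0%N then p i 0%N else 0.
Proof.
pose res q : fps R := fun i j => if j == 0%N then q i 0%N else 0.
have cf : centered (x, 0 : fps R).
  by apply: centered_pair; [apply: inm_x|apply: inm0].
suff -> : p ∘ (x, 0) = res p by [].
apply/eqP; rewrite -subr_eq0; apply/eqP; move: p.
apply: (inm_coind (D1 := @divx R) (D2 := @divy R) cf.1 cf.2) => p.
have -> : res p = cst (p 0%N 0%N) + x * res (divx p).
  apply: fpsP => k l; rewrite fpsDE xME /res /cst /psC /divx.
  by case: k l => [|k] [|l] //=; rewrite ?addr0 ?add0r.
by rewrite (comp_split _ cf) /fst_ /snd_ /=; ring.
Qed.

Lemma comp_0yE p i j : (p ∘ (0, y)) i j = if i == 0%N then p 0%N j else 0.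
Proof.
pose res q : fps R := fun i j => if i == 0%N then q 0%N j else 0.
have cf : centered (0 : fps R, y).
  by apply: centered_pair; [apply: inm0|apply: inm_y].
suff -> : p ∘ (0, y) = res p by [].
apply/eqP; rewrite -subr_eq0; apply/eqP; move: p.
apply: (inm_coind (D1 := @divx R) (D2 := @divy R) cf.1 cf.2) => p.
have -> : res p = cst (p 0%N 0%N) + y * res (divy p).
  apply: fpsP => k l; rewrite fpsDE yME /res /cst /psC /divy.
  by case: k l => [|k] [|l] //=; rewrite ?addr0 ?add0r.
by rewrite (comp_split _ cf) /fst_ /snd_ /=; ring.
Qed.

Section Kernel.
Variables f g : germ R.
Hypotheses (cf : centered f) (cg : centered g) (gK : gcomp g f = id_).

Lemma comp_invK p : (p ∘ g) ∘ f = p.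
Proof. by rewrite compA // gK comp_id. Qed.

(** In the coordinates f, with inverse g, the composite parametrizes the axis where the second
    coordinate vanishes; a series that is zero on it is divisible by that coordinate. *)
Lemma ker_x0 p : p ∘ gcomp g (x, 0) = 0 -> exists q, p = snd_ f * q.
Proof.
rewrite -compA // => [p0|]; last first.
  by apply: centered_pair; [apply: inm_x|apply: inm0].
pose q : fps R := fun i j => (p ∘ g) i j.+1.
have -> : p = snd_ f * (q ∘ f); last by exists (q ∘ f).
rewrite -comp_y // -[LHS]comp_invK; congr comp; apply: fpsP => i j.
rewrite yME; case: j => // .
by move/(congr1 (fun r : fps R => r i 0%N)): p0; rewrite comp_x0E.
Qed.

Lemma ker_0y p : p ∘ gcomp g (0, y) = 0 -> exists q, p = fst_ f * q.
Proof.
rewrite -compA // => [p0|]; last first.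
  by apply: centered_pair; [apply: inm0|apply: inm_y].
pose q : fps R := fun i j => (p ∘ g) i.+1 j.
have -> : p = fst_ f * (q ∘ f); last by exists (q ∘ f).
rewrite -comp_x // -[LHS]comp_invK; congr comp; apply: fpsP => i j.
rewrite xME; case: i => // .
by move/(congr1 (fun r : fps R => r 0%N j)): p0; rewrite comp_0yE.
Qed.

End Kernel.

Lemma contraction_fixpoint (K : fps R -> fps R) :
  (forall p, inm 1 p -> inm 1 (K p)) ->
  (forall n p q, inm 1 p -> inm 1 q -> inm n (p - q) -> inm n.+1 (K p - K q)) ->
  exists2 p, inm 1 p & K p = p.
Proof.
move=> K1 Kc; pose u n := iter n K 0.
have u1 n : inm 1 (u n) by elim: n => [|n IHn]; [apply: inm0|exact: (K1 (u n))].
have uS n : inm n (u n.+1 - u n) by elim: n => [//|n IHn]; exact: (Kc n (u n.+1) (u n)).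
have uD n m : inm n (u (n + m)%N - u n).
  elim: m => [|m IHm]; first by rewrite addn0 subrr.
  rewrite addnS -[_ - _](subrKA (u (n + m)%N)).
  by apply: inmD => //; apply: inmW (uS _); apply: leq_addr.
(* The iterates agree modulo m^n from index n on, so the coefficient at (i, j) is final from the
   iterate i + j + 1. *)
pose p : fps R := fun i j => u (i + j).+1 i j.
have pu n : inm n (p - u n).
  move=> i j lt; rewrite fpsBE /p; have := uD (i + j).+1 (n - (i + j).+1)%N i j.
  rewrite subnKC // => /(_ (ltnSn _)) /eqP; rewrite fpsBE subr_eq0 => /eqP ->.
  by rewrite subrr.
have p1 : inm 1 p by rewrite -[p](subrK (u 1%N)); apply: inmD.
exists p => //; apply/eqP; rewrite -subr_eq0; apply/eqP; apply: inm_eq0 => n.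
rewrite -[K p - p](subrKA (u n.+1)); apply: inmD.
  by apply: (@inmW _ _ n.+1) => //; apply: Kc.
by rewrite -opprB; apply: inmN; apply: inmW (pu n.+1).
Qed.

Variables (lam : C) (g : germ R).
Hypotheses (lam0 : lam != 0) (cg : centered g).
Hypotheses (g1 : inm 2 (fst_ g - cst lam * x)) (g2 : inm 2 (snd_ g)).

Let inmx := inm_x R.
Let inmy := inm_y R.
Let inm_cx c : inm 1 (cst c * x).
Proof. exact: inmMl. Qed.

Let comp_cx c (a b : fps R) : inm 1 a -> inm 1 b -> (cst c * x) ∘ (a, b) = cst c * a.
Proof. by move=> ha hb; rewrite compM // comp_cst compX. Qed.

(** Invariance of the graph y = phi(x). The unknown is a series in two variables whose second
    variable is carried along as a parameter, to be set to 0 in [stable_curve]. *)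
Lemma stable_fixpoint : exists2 phi, inm 2 phi &
  snd_ g ∘ (x, phi) = phi ∘ (fst_ g ∘ (x, phi), y).
Proof.
(* The leading part of p -> p(g_1(x, p), y) is p -> p(lam x, y), inverted by rescaling x. What
   remains gains one order, because g_1 - lam x and g_2 lie in m^2. *)
pose E p := snd_ g ∘ (x, p) - p ∘ (fst_ g ∘ (x, p), y) + p ∘ (cst lam * x, y).
pose K p := E p ∘ (cst lam^-1 * x, y).
have cx p : inm 1 p -> centered (x, p) by move=> hp; apply: centered_pair.
have ch p : inm 1 p -> centered (fst_ g ∘ (x, p), y).
  by move=> hp; apply: centered_pair => //; apply: inm_comp (cx _ hp) cg.1.
have cl c : centered (cst c * x, y) by apply: centered_pair.
have hsub p : inm 1 p -> inm 2 (fst_ g ∘ (x, p) - cst lam * x).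
  move=> hp; rewrite -[cst lam * x](@comp_cx lam x p) // -compB.
  exact: inm_comp (cx _ hp) g1.
have E2 p : inm 1 p -> inm 2 (E p).
  move=> hp; rewrite /E -addrA; apply: inmD; first exact: inm_comp (cx _ hp) g2.
  rewrite addrC -opprB; apply: inmN.
  apply: (inm_comp_sub (n := 2) (k := 1) (ch _ hp) (cl lam)) => //=; first exact: hsub.
  by rewrite /snd_ /= subrr.
have K2 p : inm 1 p -> inm 2 (K p).
  by move=> hp; apply: inm_comp => //; apply: E2.
have [||phi phi1 Kphi] := @contraction_fixpoint K.
- by move=> p hp; apply: inmW (K2 _ hp).
- move=> n p q hp hq hpq; rewrite /K -compB; apply: inm_comp => //.
  have -> : E p - E q = (snd_ g ∘ (x, p) - snd_ g ∘ (x, q))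
    - ((p - q) ∘ (fst_ g ∘ (x, p), y) - (p - q) ∘ (cst lam * x, y))
    - (q ∘ (fst_ g ∘ (x, p), y) - q ∘ (fst_ g ∘ (x, q), y)).
    by rewrite /E !compB; ring.
  apply: inmB; first apply: inmB.
  + apply: inmW (inm_comp_sub (cx _ hp) (cx _ hq) (n := n) _ hpq g2); first lia.
    by rewrite /fst_ /= subrr.
  + apply: inmW (inm_comp_sub (ch _ hp) (cl lam) (n := 2) _ _ hpq); first lia.
      exact: hsub.
    by rewrite /snd_ /= subrr.
  + apply: inmW (inm_comp_sub (ch _ hp) (ch _ hq) (n := n.+1) _ _ hq); first lia.
      rewrite /fst_ /= -/(fst_ g).
      have -> : fst_ g ∘ (x, p) - fst_ g ∘ (x, q) =
          (fst_ g - cst lam * x) ∘ (x, p) - (fst_ g - cst lam * x) ∘ (x, q).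
        by rewrite !compB !comp_cx //; ring.
      apply: inmW (inm_comp_sub (cx _ hp) (cx _ hq) (n := n) _ hpq g1); first lia.
      by rewrite /fst_ /= subrr.
    by rewrite /snd_ /= subrr.
exists phi; first by rewrite -Kphi; apply: K2.
have := congr1 (comp (cst lam * x, y)) Kphi.
rewrite /K comp_pairA // comp_cx // compY // /snd_ /= mulrA -cstM mulVf // mul1r.
rewrite [_ ∘ (x, y)]comp_id /E => /eqP; rewrite -subr_eq0 addrK subr_eq0.
by move/eqP.
Qed.

Lemma stable_curve : exists2 phi, inm 2 phi &
  exists2 b : fps R, b 0%N 0%N = 0 & (y - phi) ∘ g = (y - phi) * b.
Proof.
have [phi1 h1 ephi1] := stable_fixpoint.
have h1' : inm 1 phi1 by apply: inmW h1.
have cZ : centered (x, 0 : fps R) by apply: centered_pair.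
pose phi := phi1 ∘ (x, 0).
have phi2 : inm 2 phi by apply: inm_comp.
have hphi : inm 1 phi by apply: inmW phi2.
have phi_x a b : inm 1 a -> inm 1 b -> phi ∘ (a, b) = phi1 ∘ (a, 0).
  by move=> ha hb; rewrite /phi comp_pairA // compX // comp0.
have hY : inm 1 (y - phi) by apply: inmB.
have hY' : inm 1 (y + phi) by apply: inmD.
have inv : gcomp (x, y + phi) (x, y - phi) = id_.
  rewrite /gcomp /fst_ /snd_ /= compX // compD compY // phi_x //.
  by rewrite /fst_ /snd_ /= -/phi subrK.
have gam : gcomp (x, y + phi) (x, 0) = (x, phi).
  rewrite /gcomp /fst_ /snd_ /= compX // compD compY // phi_x //.
  by rewrite /fst_ /snd_ /= -/phi add0r.
have cphi : centered (x, phi) by apply: centered_pair.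
have ephi : snd_ g ∘ (x, phi) = phi ∘ gcomp g (x, phi).
  have := congr1 (comp (x, 0)) ephi1.
  have hg p : inm 1 p -> inm 1 (fst_ g ∘ (x, p)) by move=> hp; apply: inm_comp cg.1.
  rewrite (@comp_pairA (snd_ g)) // (@comp_pairA phi1) //; last exact: hg.
  rewrite (@comp_pairA (fst_ g)) // compX // compY // -/phi => ->.
  by rewrite /gcomp phi_x; [|exact: hg|exact: inm_comp cg.2].
exists phi => //.
have [|||b eb] := @ker_x0 (x, y - phi) (x, y + phi) _ _ inv ((y - phi) ∘ g) => //.
  rewrite gam compA // compB compY; last exact: centered_gcomp.
  by rewrite -ephi; apply: subrr.
exists b => //; have := comp_01 (y - phi) cg; rewrite eb fps_01M /snd_ /=.
rewrite !fpsBE !phi2 // /y_ /= !subr0 !(mul0r, mul1r, add0r) => ->.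
by rewrite -/(snd_ g) g2 // .
Qed.

(** Invariance of the graph x = theta(y). Here lam is inverted as a scalar multiplying the unknown,
    and substituting g_2, which lies in m^2, into the unknown raises its order. *)
Lemma unstable_fixpoint : exists2 theta, inm 2 theta &
  fst_ g ∘ (theta, y) = theta ∘ (0, snd_ g ∘ (theta, y)).
Proof.
pose F := fst_ g - cst lam * x.
pose K p := cst lam^-1 * (p ∘ (0, snd_ g ∘ (p, y)) - F ∘ (p, y)).
have cy p : inm 1 p -> centered (p, y) by move=> hp; apply: centered_pair.
have G2 p : inm 1 p -> inm 2 (snd_ g ∘ (p, y)).
  by move=> hp; apply: inm_comp (cy _ hp) g2.
have ch p : inm 1 p -> centered (0 : fps R, snd_ g ∘ (p, y)).
  by move=> hp; apply: centered_pair => //; apply: inmW (G2 _ hp).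
have c00 : centered (0 : fps R, 0 : fps R) by apply: centered_pair.
(* Order 0 is exceptional because a constant term survives the substitution; there the contraction
   bound only asks for order 1, which holds since both series lie in m. *)
have van n p q : inm 1 q -> inm n p -> inm n.+1 (p ∘ (0, snd_ g ∘ (q, y))) \/ n = 0%N.
  case: n => [|n] hq hp; [by right|left].
  have e0 : p ∘ (0, 0) = 0.
    rewrite (comp_split _ c00) /fst_ /snd_ /= hp //.
    by rewrite cst0; ring.
  rewrite (_ : p ∘ _ = p ∘ (0, snd_ g ∘ (q, y)) - p ∘ (0, 0)); last by rewrite e0 subr0.
  apply: inmW (inm_comp_sub (ch _ hq) c00 (n := 2) _ _ hp); first lia.
    by rewrite /fst_ /= subrr.
  by rewrite /snd_ /= subr0; apply: G2.
have K2 p : inm 1 p -> inm 2 (K p).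
  move=> hp; apply: inmMl; apply: inmB; last exact: inm_comp (cy _ hp) g1.
  by have [] := van _ _ _ hp hp.
have [||theta theta1 Kt] := @contraction_fixpoint K.
- by move=> p hp; apply: inmW (K2 _ hp).
- move=> n p q hp hq hpq; rewrite /K -mulrBr; apply: inmMl.
  have -> : p ∘ (0, snd_ g ∘ (p, y)) - F ∘ (p, y)
      - (q ∘ (0, snd_ g ∘ (q, y)) - F ∘ (q, y)) =
    (p - q) ∘ (0, snd_ g ∘ (p, y))
    + (q ∘ (0, snd_ g ∘ (p, y)) - q ∘ (0, snd_ g ∘ (q, y)))
    - (F ∘ (p, y) - F ∘ (q, y)).
    by rewrite !compB; ring.
  have y0 m (a b : fps R) : inm m (snd_ (a, y) - snd_ (b, y)).
    by rewrite /snd_ /= subrr.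
  apply: inmB; first apply: inmD.
  + have [//|n0] := van _ _ _ hp hpq; rewrite n0.
    by apply: inm_comp; [apply: ch|apply: inmB].
  + apply: inmW (inm_comp_sub (ch _ hp) (ch _ hq) (n := n.+1) _ _ hq); first lia.
      by rewrite /fst_ /= subrr.
    rewrite /snd_ /= -/(snd_ g).
    by apply: inmW (inm_comp_sub (cy _ hp) (cy _ hq) hpq (y0 _ _ _) g2); lia.
  + by apply: inmW (inm_comp_sub (cy _ hp) (cy _ hq) hpq (y0 _ _ _) g1); lia.
exists theta; first by rewrite -Kt; apply: K2.
have := congr1 ( *%R (cst lam)) Kt.
rewrite /K mulrA -cstM mulfV // mul1r /F compB comp_cx // => /eqP.
by rewrite opprB addrA subr_eq [X in _ == X]addrC => /eqP/addIr <-.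
Qed.

Lemma unstable_curve : exists2 theta, inm 2 theta &
  exists2 a : fps R, a 0%N 0%N != 0 & (x - theta) ∘ g = (x - theta) * a.
Proof.
have [theta1 h1 et1] := unstable_fixpoint.
have h1' : inm 1 theta1 by apply: inmW h1.
have cZ : centered (0 : fps R, y) by apply: centered_pair.
pose theta := theta1 ∘ (0, y).
have theta2 : inm 2 theta by apply: inm_comp.
have ht : inm 1 theta by apply: inmW theta2.
have theta_y a b : inm 1 a -> inm 1 b -> theta ∘ (a, b) = theta1 ∘ (0, b).
  by move=> ha hb; rewrite /theta comp_pairA // compY // comp0.
have hX : inm 1 (x - theta) by apply: inmB.
have hX' : inm 1 (x + theta) by apply: inmD.
have inv : gcomp (x + theta, y) (x - theta, y) = id_.
  rewrite /gcomp /fst_ /snd_ /= compY // compD compX // theta_y //.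
  by rewrite /fst_ /snd_ /= -/theta subrK.
have gam : gcomp (x + theta, y) (0, y) = (theta, y).
  rewrite /gcomp /fst_ /snd_ /= compY // compD compX // theta_y //.
  by rewrite /fst_ /snd_ /= -/theta add0r.
have ct : centered (theta, y) by apply: centered_pair.
have et : fst_ g ∘ (theta, y) = theta ∘ gcomp g (theta, y).
  have := congr1 (comp (0, y)) et1.
  have hg p : inm 1 p -> inm 1 (snd_ g ∘ (p, y)) by move=> hp; apply: inm_comp cg.2.
  rewrite (@comp_pairA (fst_ g)) // (@comp_pairA theta1) //; last exact: hg.
  rewrite (@comp_pairA (snd_ g)) // comp0 compY // -/theta => ->.
  by rewrite /gcomp theta_y; [|exact: inm_comp cg.1|exact: hg].
exists theta => //.
have [|||a ea] := @ker_0y (x - theta, y) (x + theta, y) _ _ inv ((x - theta) ∘ g) => //.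
  rewrite gam compA // compB compX; last exact: centered_gcomp.
  by rewrite -et; apply: subrr.
(* Comparing the coefficients of x, to which theta does not contribute, gives a(0,0) = lam. *)
exists a => //; have := comp_10 (x - theta) cg; rewrite ea fps_10M /fst_ /=.
rewrite !fpsBE !theta2 // /x_ /= !subr0 !(mul0r, mul1r, add0r, addr0) => ->.
have /eqP := g1 (isT : (1 + 0 < 2)%N); rewrite fpsBE cstME /x_ /= mulr1 subr_eq0.
by move=> /eqP; rewrite /fst_ => ->.
Qed.

End InvariantCurves.

(** * Diagonalization of the linear part and coordinates with invariant axes *)

Section InvariantCoordinates.
Variable R : realType.
Local Notation C := R[i].
Implicit Types (p q r : fps R) (f g h : germ R).
Local Notation x := (x_ R).
Local Notation y := (y_ R).
Local Notation id_ := (id_ R).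

Lemma inm2I p : p 0%N 0%N = 0 -> p 1%N 0%N = 0 -> p 0%N 1%N = 0 -> inm 2 p.
Proof. by move=> ? ? ? [|[|i]] [|[|j]]. Qed.

(** [eigenvalue] refers to row vectors, so eigenvectors of [df0 f] are linear forms u with u ∘ df_0
    a multiple of u: exactly what serves as new coordinates. *)
Lemma eigenforms f : semi_superattracting f ->
  exists lam (v w : C * C), [/\ lam != 0, v.1 * w.2 - v.2 * w.1 != 0,
    v.1 * fst_ f 1%N 0%N + v.2 * snd_ f 1%N 0%N = lam * v.1,
    v.1 * fst_ f 0%N 1%N + v.2 * snd_ f 0%N 1%N = lam * v.2 &
    w.1 * fst_ f 1%N 0%N + w.2 * snd_ f 1%N 0%N = 0 /\
    w.1 * fst_ f 0%N 1%N + w.2 * snd_ f 0%N 1%N = 0].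
Proof.
move=> [lam [lam0 ev]].
have evP z : eigenvalue (df0 f) z -> exists v : C * C, [/\ (v.1 != 0) || (v.2 != 0),
    v.1 * fst_ f 1%N 0%N + v.2 * snd_ f 1%N 0%N = z * v.1 &
    v.1 * fst_ f 0%N 1%N + v.2 * snd_ f 0%N 1%N = z * v.2].
  move=> /eigenvalueP[u eu u0]; exists (u 0 0, u 0 1); split=> /=.
  - apply: contraNT u0; rewrite negb_or !negbK => /andP[/eqP e0 /eqP e1].
    apply/eqP/rowP => i; rewrite mxE.
    by case: i => -[|[|i]] //= lt; [rewrite -[RHS]e0|rewrite -[RHS]e1]; congr (u _ _); apply: val_inj.
  - have /matrixP/(_ 0 0) := eu; rewrite !mxE !big_ord_recl big_ord0 addr0 !mxE /=.
    by rewrite (_ : lift _ _ = 1) //; apply: val_inj.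
  - have /matrixP/(_ 0 1) := eu; rewrite !mxE !big_ord_recl big_ord0 addr0 !mxE /=.
    by rewrite (_ : lift _ _ = 1) //; apply: val_inj.
have /evP[v [v0 v1 v2]] : eigenvalue (df0 f) lam by rewrite ev eqxx orbT.
have /evP[w [w0 w1 w2]] : eigenvalue (df0 f) 0 by rewrite ev eqxx.
rewrite !mul0r in w1 w2.
exists lam, v, w; split=> //; apply/eqP => d0.
(* If the determinant were zero, v and w would be proportional, and the two eigenvalue equations
   would kill all four products lam v_i w_j, although neither v nor w is zero. *)
have e1 : lam * (v.1 * w.2) = 0.
  transitivity (w.2 * (v.1 * fst_ f 1%N 0%N + v.2 * snd_ f 1%N 0%N)
     - v.2 * (w.1 * fst_ f 1%N 0%N + w.2 * snd_ f 1%N 0%N)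
     - (v.1 * w.2 - v.2 * w.1) * fst_ f 1%N 0%N); last by ring.
  by rewrite v1 w1 d0; ring.
have e2 : lam * (v.2 * w.2) = 0.
  transitivity (w.2 * (v.1 * fst_ f 0%N 1%N + v.2 * snd_ f 0%N 1%N)
     - v.2 * (w.1 * fst_ f 0%N 1%N + w.2 * snd_ f 0%N 1%N)
     - (v.1 * w.2 - v.2 * w.1) * fst_ f 0%N 1%N); last by ring.
  by rewrite v2 w2 d0; ring.
have e3 : lam * (v.1 * w.1) = 0.
  transitivity (w.1 * (v.1 * fst_ f 1%N 0%N + v.2 * snd_ f 1%N 0%N)
     - v.1 * (w.1 * fst_ f 1%N 0%N + w.2 * snd_ f 1%N 0%N)
     + (v.1 * w.2 - v.2 * w.1) * snd_ f 1%N 0%N); last by ring.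
  by rewrite v1 w1 d0; ring.
have e4 : lam * (v.2 * w.1) = 0.
  transitivity (w.1 * (v.1 * fst_ f 0%N 1%N + v.2 * snd_ f 0%N 1%N)
     - v.1 * (w.1 * fst_ f 0%N 1%N + w.2 * snd_ f 0%N 1%N)
     + (v.1 * w.2 - v.2 * w.1) * snd_ f 0%N 1%N); last by ring.
  by rewrite v2 w2 d0; ring.
move: e1 e2 e3 e4 => /eqP + /eqP + /eqP + /eqP.
rewrite !mulf_eq0 (negbTE lam0) /=.
by move: v0 w0; do 4!case: eqP.
Qed.

Lemma diagonalization f : centered f -> semi_superattracting f ->
  exists lam L g, [/\ lam != 0, autom L, centered g, gcomp L f = gcomp g L &
    inm 2 (fst_ g - cst lam * x) /\ inm 2 (snd_ g)].
Proof.
move=> cf /eigenforms[lam [v [w [lam0 d0 v1 v2 [w1 w2]]]]].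
pose l (u : C * C) := cst u.1 * x + cst u.2 * y.
have lE u : [/\ l u 0%N 0%N = 0, l u 1%N 0%N = u.1 & l u 0%N 1%N = u.2].
  by rewrite /l; split; rewrite fpsDE !cstME /x_ /y_ /= ?mulr1 !mulr0 ?addr0 ?add0r.
have l1 u : inm 1 (l u) by apply/inm1P; case: (lE u).
pose L : germ R := (l v, l w).
have aL : autom L.
  apply/automE; split; first by split; apply: l1.
  by rewrite /det /L /fst_ /snd_ /=; have [_ -> ->] := lE v; have [_ -> ->] := lE w.
have cL := autom_centered aL.
have [P [aP [PL LP]]] := autom_inv aL; have cP := autom_centered aP.
exists lam, L, (gcomp (gcomp L f) P); split=> //; last split.
- by apply: centered_gcomp => //; apply: centered_gcomp.
- by rewrite gcompA // PL gcomp_id.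
- have -> : fst_ (gcomp (gcomp L f) P) - cst lam * x = (l v ∘ f - cst lam * l v) ∘ P.
    rewrite compB (compM _ (l v)) // comp_cst /gcomp /fst_ /=.
    by congr (_ - _ * _); move: LP => [].
  apply: inm_comp => //; have [e0 e1 e2] := lE v.
  apply: inm2I; rewrite fpsBE cstME ?comp_00 ?comp_10 ?comp_01 ?e0 ?e1 ?e2 //.
  + by rewrite mulr0 subrr.
  + by rewrite v1 subrr.
  + by rewrite v2 subrr.
- rewrite (_ : snd_ _ = (l w ∘ f) ∘ P) //.
  apply: inm_comp => //; have [e0 e1 e2] := lE w.
  by apply: inm2I; rewrite ?comp_00 ?comp_10 ?comp_01 ?e0 ?e1 ?e2.
Qed.

(* The axes {fst_ A = 0} and {snd_ A = 0} are f-invariant; they are tangent to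
   the eigendirections of df_0 for the eigenvalues 0 and lambda respectively. *)
Lemma invariant_coordinates f : centered f -> semi_superattracting f ->
  exists A a b, [/\ autom A, fst_ A ∘ f = fst_ A * a, snd_ A ∘ f = snd_ A * b,
    a 0%N 0%N != 0 & b 0%N 0%N = 0].
Proof.
move=> cf sf; have [lam [L [g [lam0 aL cg gE [g1 g2]]]]] := diagonalization cf sf.
have cL := autom_centered aL.
have [phi phi2 [b b0 eb]] := stable_curve lam0 cg g1 g2.
have [theta theta2 [a a0 ea]] := unstable_curve lam0 cg g1 g2.
pose A : germ R := (x - theta, y - phi).
have aA : autom A.
  apply/automE; split.
    split; apply: inmB; [exact: inm_x|exact: inmW theta2|exact: inm_y|exact: inmW phi2].
  rewrite /det /A /fst_ /snd_ /= !fpsBE !theta2 // !phi2 // !subr0 /x_ /y_ /=.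
  by rewrite mulr1 mulr0 subr0 oner_neq0.
have push_eq p : (p ∘ L) ∘ f = (p ∘ g) ∘ L by rewrite !compA // gE.
exists (gcomp A L), (a ∘ L), (b ∘ L); split; first exact: autom_gcomp.
- by rewrite /gcomp {1}/fst_ /= push_eq ea compM.
- by rewrite /gcomp {1}/snd_ /= push_eq eb compM.
- by rewrite comp_00.
- by rewrite comp_00.
Qed.

End InvariantCoordinates.

(** * Valuations and monomial valuations *)

Section Valuations.
Variable R : realType.
Local Notation C := R[i].
Implicit Types (p q r : fps R) (f g A P : germ R) (nu mu w : fps R -> \bar R).
Local Notation x := (x_ R).
Local Notation y := (y_ R).
Local Notation id_ := (id_ R).
Local Open Scope ereal_scope.

Section Basic.
Variable nu : fps R -> \bar R.
Hypothesis vnu : valuation nu.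

Lemma val_ge0 p : 0 <= nu p. Proof. by case: vnu. Qed.
Lemma valM p q : nu (p * q)%R = nu p + nu q. Proof. by case: vnu => _ [h _]; apply: h. Qed.
Lemma valD p q : Order.min (nu p) (nu q) <= nu (p + q)%R.
Proof. by case: vnu => _ [_ [h _]]; apply: h. Qed.
Lemma val0 : nu 0%R = +oo. Proof. by case: vnu => _ [_ [_ [h _]]]; apply: h. Qed.
Lemma val_cst c : c != 0%R -> nu (cst c) = 0.
Proof. by case: vnu => _ [_ [_ [_ [h _]]]]; apply: h. Qed.
Lemma val_inm p : inm 1 p -> 1 <= nu p.
Proof. by move/inm1P; case: vnu => _ [_ [_ [_ [_ [h _]]]]]; apply: h. Qed.
Lemma val_ex : exists2 p, inm 1 p & nu p = 1.
Proof.
by case: vnu => _ [_ [_ [_ [_ [_ [p [hp p1]]]]]]]; exists p => //; apply/inm1P.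
Qed.

Lemma val_1 : nu 1%R = 0. Proof. by rewrite -cst1 val_cst ?oner_neq0. Qed.

Lemma val_unit p : p 0%N 0%N != 0%R -> nu p = 0.
Proof.
move=> /inv_ex[q pq]; apply/eqP; rewrite eq_le val_ge0 andbT.
by rewrite -val_1 -pq valM leeDl // val_ge0.
Qed.

Lemma valN p : nu (- p)%R = nu p.
Proof.
have -> : (- p = cst (-1) * p)%R by apply: fpsP => i j; rewrite cstME mulN1r.
by rewrite valM val_cst ?add0e // oppr_eq0 oner_neq0.
Qed.

Lemma valD_lt p q : nu p < nu q -> nu (p + q)%R = nu p.
Proof.
move=> lt; apply/eqP; rewrite eq_le andbC; apply/andP; split.
  by apply: le_trans (valD p q); rewrite min_l // ltW.
have := valD (p + q)%R (- q)%R; rewrite addrK valN ge_min.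
by case/orP => // /(lt_le_trans lt); rewrite ltxx.
Qed.

Lemma valD_ge z p q : z <= nu p -> z <= nu q -> z <= nu (p + q)%R.
Proof. by move=> zp zq; apply: le_trans (valD p q); rewrite le_min zp. Qed.

Lemma valX n p : nu (p ^+ n)%R = n%:R%:E * nu p.
Proof.
elim: n => [|n IHn]; first by rewrite expr0 val_1 mul0e.
rewrite exprS valM IHn -natr1 EFinD ge0_muleDl ?lee_fin ?mul1e 1?addeC //.
Qed.

End Basic.

Section Monomial.
Variables a b : R.

Lemma monoval_ge z p :
  (forall i j, p i j != 0%R -> z <= (a * i%:R + b * j%:R)%:E) -> z <= monoval a b p.
Proof. by move=> h; apply: le_ereal_inf_tmp => _ [i [j [pij ->]]]; apply: h. Qed.

Lemma monoval_le p i j : p i j != 0%R -> monoval a b p <= (a * i%:R + b * j%:R)%:E.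
Proof. by move=> h; apply: ereal_inf_lbound; exists i, j. Qed.

Lemma monoval0 : monoval a b (0%R : fps R) = +oo.
Proof.
by apply/eqP; rewrite -leye_eq; apply: monoval_ge => i j; rewrite fps0E eqxx.
Qed.

Lemma monovalD p q :
  Order.min (monoval a b p) (monoval a b q) <= monoval a b (p + q)%R.
Proof.
apply: monoval_ge => i j h; rewrite ge_min.
have [p0|p0] := eqVneq (p i j) 0%R; last by rewrite monoval_le.
by rewrite (@monoval_le q) ?orbT //; rewrite fpsDE p0 add0r in h.
Qed.

Lemma monovalE p i j : p i j != 0%R ->
  (forall k l, p k l != 0%R -> a * i%:R + b * j%:R <= a * k%:R + b * l%:R)%R ->
  monoval a b p = (a * i%:R + b * j%:R)%:E.
Proof.
move=> pij h; apply/eqP; rewrite eq_le monoval_le //=.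
by apply: monoval_ge => k l pkl; rewrite lee_fin h.
Qed.

Hypotheses (a0 : (0 < a)%R) (b0 : (0 < b)%R).

(** Several monomials may share the least weight. Taking the least exponent of y among them singles
    one out; this tie-break is used for the multiplicativity of [monoval] and in [val_le_mono]. *)
Lemma leading_monomial p : p <> 0%R -> exists i j, p i j != 0%R /\
  forall k l, p k l != 0%R -> (a * i%:R + b * j%:R <= a * k%:R + b * l%:R)%R /\
    (a * k%:R + b * l%:R = a * i%:R + b * j%:R -> (j <= l)%N)%R.
Proof.
move=> /eqP p0.
have [i0 [j0 p00]] : exists i j, p i j != 0%R.
  apply: contrapT => h; case/eqP: p0; apply: fpsP => i j.
  by apply/eqP/negPn/negP => pij; apply: h; exists i, j.
pose r := (a * i0%:R + b * j0%:R)%R.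
(* Monomials of weight at most that of a known one lie in a finite box, so the minimum is a minimum
   over a finite type. *)
have wt_bound c d (k : nat) : (0 < c -> 0 <= d -> c * k%:R + d <= r ->
    (k < (Num.truncn (r / c)).+1)%N)%R.
  move=> c0 d0 h; rewrite ltnS; have kr : (k%:R <= r / c)%R.
    by rewrite ler_pdivlMr // mulrC (le_trans _ h) // lerDl.
  by rewrite truncn_ge_nat // (le_trans _ kr).
pose N := (Num.truncn (r / a)).+1; pose M := (Num.truncn (r / b)).+1.
have ltN k l : (a * k%:R + b * l%:R <= r)%R -> (k < N)%N.
  by apply: wt_bound; rewrite // mulr_ge0 // ltW.
have ltM k l : (a * k%:R + b * l%:R <= r)%R -> (l < M)%N.
  by rewrite addrC; apply: wt_bound; rewrite // mulr_ge0 // ltW.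
pose F (u : 'I_N * 'I_M) : R *l nat := ((a * u.1%:R + b * u.2%:R)%R, u.2 : nat).
pose P (u : 'I_N * 'I_M) := p u.1 u.2 != 0%R.
have := @arg_minP _ _ _ (Ordinal (ltN _ _ (lexx r)), Ordinal (ltM _ _ (lexx r))) P F p00.
case=> -[i j] /= pij hmin; exists i, j; split=> // k l pkl.
have minr : (a * i%:R + b * j%:R <= r)%R.
  have /hmin := p00 : P (Ordinal (ltN _ _ (lexx r)), Ordinal (ltM _ _ (lexx r))).
  by rewrite lexi_pair /= => /andP[].
have [rlt|rge] := ltP r (a * k%:R + b * l%:R)%R.
  split; first by rewrite ltW // (le_lt_trans minr).
  by move=> e; move: rlt; rewrite e ltNge minr.
have /hmin := pkl : P (Ordinal (ltN _ _ rge), Ordinal (ltM _ _ rge)).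
by rewrite lexi_pair /= => /andP[le /implyP himp]; split=> // e; apply: himp; rewrite e.
Qed.

Lemma monovalM p q : monoval a b (p * q)%R = monoval a b p + monoval a b q.
Proof.
have ge0 r : 0 <= monoval a b r.
  by apply: monoval_ge => i j _; rewrite lee_fin addr_ge0 // mulr_ge0 // ltW.
have [->|/eqP p0] := eqVneq p 0%R.
  by rewrite mul0r monoval0 addye // -ltNye (lt_le_trans _ (ge0 _)).
have [->|/eqP q0] := eqVneq q 0%R.
  by rewrite mulr0 monoval0 addey // -ltNye (lt_le_trans _ (ge0 _)).
have [i [j [pij pmin]]] := leading_monomial p0.
have [k [l [qkl qmin]]] := leading_monomial q0.
rewrite (monovalE pij) => [|s t /pmin[]//]; rewrite (monovalE qkl) => [|s t /qmin[]//].
(* Both weights are minimal and their sum is prescribed, so both are attained; the two tie-breaks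
   then give j <= t and t <= j. Hence the product of the leading terms cannot be cancelled. *)
have cross s t : (s <= i + k)%N -> (t <= j + l)%N -> p s t != 0%R ->
    q (i + k - s)%N (j + l - t)%N != 0%R -> s = i /\ t = j.
  move=> les let_ /pmin[p1 p2] /qmin[q1 q2].
  move: q1 q2; rewrite !natrB // !natrD => q1 q2.
  have e1 : (a * s%:R + b * t%:R = a * i%:R + b * j%:R)%R by lra.
  have e2 := q2 ltac:(lra); have e3 := p2 e1.
  have etj : t = j by lia.
  by move: e1; rewrite etj => /addIr/mulfI; rewrite gt_eqF // => /(_ isT)/eqP; rewrite eqr_nat => /eqP.
have lead : (p * q)%R (i + k)%N (j + l)%N = (p i j * q k l)%R.
  have ltik : (i < (i + k).+1)%N by lia.
  have ltjl : (j < (j + l).+1)%N by lia.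
  rewrite fpsME (bigD1 (Ordinal ltik)) //= (bigD1 (Ordinal ltjl)) //=.
  rewrite !addKn big1 ?addr0 => [|t nt]; last first.
    apply/eqP; rewrite mulf_eq0; apply/norP => -[h1].
    rewrite -[X in q X _](addKn i k) => h2.
    have [|||//|_ tj] := cross i t; rewrite ?leq_addr // -1?ltnS //.
    by case/eqP: nt; apply: val_inj.
  rewrite big1 ?addr0 // => s ns; rewrite big1 // => t _.
  apply/eqP; rewrite mulf_eq0; apply/norP => -[h1 h2].
  have [|||//|si _] := cross s t; rewrite // -1?ltnS //.
  by case/eqP: ns; apply: val_inj.
rewrite (@monovalE _ (i + k)%N (j + l)%N) ?lead ?mulf_neq0 //.
  by rewrite -EFinD !natrD; congr EFin; ring.
move=> s t; rewrite fpsME => h.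
have [u [v [pu qv]]] : exists (u : 'I_s.+1) (v : 'I_t.+1),
    p u v != 0%R /\ q (s - u)%N (t - v)%N != 0%R.
  apply: contrapT => H; case/eqP: h; rewrite big1 // => u _; rewrite big1 // => v _.
  by apply/eqP; rewrite mulf_eq0; apply/norP => -[h1 h2]; apply: H; exists u, v.
have [p1 _] := pmin _ _ pu; have [q1 _] := qmin _ _ qv.
by move: q1; rewrite !natrB -1?ltnS // !natrD; lra.
Qed.

End Monomial.

End Valuations.

(** * Curve valuations in adapted coordinates *)

Section Coordinates.
Variable R : realType.
Local Notation C := R[i].
Implicit Types (p q r : fps R) (nu mu w : fps R -> \bar R).
Local Notation x := (x_ R).
Local Notation y := (y_ R).
Local Notation id_ := (id_ R).
Local Open Scope ereal_scope.

Lemma mult_monoval p : mult p = monoval 1 1 p.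
Proof.
rewrite /mult /monoval; congr ereal_inf; apply/seteqP.
by split=> z [i [j [pij ->]]]; exists i, j; rewrite !mul1r natrD.
Qed.

Lemma mult_smooth p : p 0%N 0%N = 0%R -> (p 1%N 0%N != 0%R) || (p 0%N 1%N != 0%R) ->
  mult p = 1.
Proof.
move=> p0 h; rewrite mult_monoval.
have ge1 k l : p k l != 0%R -> (1 <= 1 * k%:R + 1 * l%:R :> R)%R.
  rewrite !mul1r -natrD ler1n lt0n addn_eq0 => pkl.
  by apply: contra pkl => /andP[/eqP -> /eqP ->]; rewrite p0.
have [p1|p1] := orP h.
  by rewrite (monovalE p1) mulr0 mulr1 addr0.
by rewrite (monovalE p1) mulr0 mulr1 add0r.
Qed.

(** A product of two non-units has no linear part. *)
Lemma smooth_irreducible p : p 0%N 0%N = 0%R ->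
  (p 1%N 0%N != 0%R) || (p 0%N 1%N != 0%R) -> ps_irreducible p.
Proof.
move=> p0 h; split=> //; split=> [e|q r e].
  by move: h; rewrite e /ps0 eqxx.
have [q0|q0] := eqVneq (q 0%N 0%N) 0%R; last by left.
have [r0|r0] := eqVneq (r 0%N 0%N) 0%R; last by right.
by move: h; rewrite e -[psmul q r]/((q : fps R) * (r : fps R))%R (fps_10M q r) (fps_01M q r) q0 r0 !mul0r !mulr0 !addr0 eqxx.
Qed.

Variables A P : germ R.
Hypotheses (aA : autom A) (aP : autom P).
Hypotheses (PA : gcomp P A = id_) (AP : gcomp A P = id_).
Local Notation X := (fst_ A).
Local Notation Y := (snd_ A).

Let cA : centered A := autom_centered aA.
Let cP : centered P := autom_centered aP.

Lemma coordXK : X ∘ P = x. Proof. by case: AP. Qed.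
Lemma coordYK : Y ∘ P = y. Proof. by case: AP. Qed.
Lemma coordK p : (p ∘ P) ∘ A = p. Proof. exact: comp_invK. Qed.
Lemma coordVK p : (p ∘ A) ∘ P = p. Proof. by rewrite compA // AP comp_id. Qed.

Lemma smoothX : (X 1%N 0%N != 0%R) || (X 0%N 1%N != 0%R).
Proof.
have /automE[_] := aA; apply: contraNT; rewrite negb_or !negbK => /andP[/eqP e1 /eqP e2].
by rewrite /det e1 e2 !mul0r subrr.
Qed.
Lemma smoothY : (Y 1%N 0%N != 0%R) || (Y 0%N 1%N != 0%R).
Proof.
have /automE[_] := aA; apply: contraNT; rewrite negb_or !negbK => /andP[/eqP e1 /eqP e2].
by rewrite /det e1 e2 !mulr0 subrr.
Qed.
Lemma X00 : X 0%N 0%N = 0%R. Proof. exact: cA.1. Qed.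
Lemma Y00 : Y 0%N 0%N = 0%R. Proof. exact: cA.2. Qed.

Lemma max_ideal_gen p : inm 1 p -> exists q r, p = (X * q + Y * r)%R.
Proof.
move=> hp; exists (divx (p ∘ P) ∘ A), (divy (p ∘ P) ∘ A).
rewrite -comp_x // -comp_y // -compD -[LHS]coordK; congr (_ ∘ _).
by rewrite [LHS]fps_split (inm_comp cP hp) // cst0 add0r.
Qed.

Section Val.
Variable nu : fps R -> \bar R.
Hypothesis vnu : valuation nu.

Lemma val_X_ge1 : 1 <= nu X. Proof. exact: (val_inm vnu cA.1). Qed.
Lemma val_Y_ge1 : 1 <= nu Y. Proof. exact: (val_inm vnu cA.2). Qed.

(** X and Y generate the maximal ideal, so the normalization of nu is already visible on them. *)
Lemma val_XY : Order.min (nu X) (nu Y) = 1.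
Proof.
apply/eqP; rewrite eq_le le_min val_X_ge1 val_Y_ge1 !andbT.
have [p /max_ideal_gen[q [r ->]] p1] := val_ex vnu.
rewrite -p1; apply: le_trans (valD vnu _ _); rewrite !(valM vnu) le_min.
by rewrite !ge_min !leeDl ?orbT // val_ge0.
Qed.

Lemma val_X1 : 1 < nu Y -> nu X = 1.
Proof.
move=> lt; have := val_XY; rewrite /Order.min; case: ifP => // _ e.
by rewrite e ltxx in lt.
Qed.

(** The axioms of a valuation say nothing about infinite sums, so the bound is first capped at N.
    Each split takes off a factor X or Y, whose value is at least 1, and raises the cap by one. *)
Lemma val_ge_mono_approx (a b : R) (N : nat) (s : R) q :
  (1 <= a)%R -> (1 <= b)%R -> a%:E <= nu X -> b%:E <= nu Y ->
  (forall i j, q i j != 0 -> s <= a * i%:R + b * j%:R)%R ->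
  (Num.min s N%:R)%:E <= nu (q ∘ A).
Proof.
move=> a1 b1 aX bY; elim: N s q => [|N IHN] s q h.
  by apply: le_trans (val_ge0 vnu _); rewrite lee_fin ge_min lexx orbT.
rewrite (comp_split q cA); apply: valD_ge => //; first apply: valD_ge => //.
- have [->|q0] := eqVneq (q 0%N 0%N) 0%R; first by rewrite cst0 val0 ?leey.
  apply: le_trans (val_ge0 vnu _); rewrite lee_fin ge_min.
  by have := h _ _ q0; rewrite !mulr0 addr0 => ->.
- rewrite valM //; have h' : (Num.min (s - a) N%:R)%:E <= nu (divx q ∘ A).
    apply: IHN => i j /h; rewrite -natr1; lra.
  apply: le_trans (leeD aX h'); rewrite -EFinD lee_fin -natr1.
  by rewrite /Num.min; do 2!case: ifP; lra.
- rewrite valM //; have h' : (Num.min (s - b) N%:R)%:E <= nu (divy q ∘ A).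
    apply: IHN => i j; rewrite /divy; case: (eqVneq i 0%N) => [->|_]; last by rewrite eqxx.
    by move=> /h; rewrite -natr1; lra.
  apply: le_trans (leeD bY h'); rewrite -EFinD lee_fin -natr1.
  by rewrite /Num.min; do 2!case: ifP; lra.
Qed.

Lemma val_ge_mono (a b : R) p :
  (1 <= a)%R -> (1 <= b)%R -> a%:E <= nu X -> b%:E <= nu Y ->
  monoval a b (p ∘ P) <= nu p.
Proof.
move=> a1 b1 aX bY; rewrite -{2}[p]coordK.
have [->|/eqP q0] := eqVneq (p ∘ P) 0%R; first (rewrite comp0 (val0 vnu); exact: leey).
have a0 : (0 < a)%R by lra.
have b0 : (0 < b)%R by lra.
have [i [j [qij h]]] := leading_monomial a0 b0 q0.
rewrite (monovalE qij) => [|k l /h[]//].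
set s := (a * _ + _)%R in h *.
(* A cap above the weight of the leading monomial has no effect. *)
have -> : s = Num.min s (Num.truncn s).+1%:R.
  by rewrite min_l // ltW // truncnS_gt.
by apply: (val_ge_mono_approx _ a1 b1 aX bY) => k l /h[].
Qed.

(** The last hypothesis expresses nu <= nu_C through coefficients: nu(q) is at most the order of q
    restricted to {Y = 0}. *)
Lemma val_le_mono (b : R) p : (1 <= b)%R -> nu Y = b%:E ->
  (forall q i, (q ∘ P) i 0%N != 0%R -> nu q <= i%:R%:E) ->
  nu p <= monoval 1 b (p ∘ P).
Proof.
move=> b1 nuY hle; have b0 : (0 < b)%R by lra.
have nuX : nu X = 1.
  apply/eqP; rewrite eq_le val_X_ge1 andbT; apply: (hle X 1%N).
  by rewrite coordXK /x_ oner_neq0.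
have [e|/eqP q0] := eqVneq (p ∘ P) 0%R; first by rewrite e monoval0 leey.
set q := p ∘ P in q0 *.
have [i [j [qij h]]] := leading_monomial ltr01 b0 q0.
rewrite (monovalE qij) => [|k l /h[]//].
(* The series is cut at the y-exponent j of its leading monomial. By the tie-break the part [q2] of
   lower degree in y is strictly heavier, so nu only sees y^j q1, and q1 restricted to the axis has
   the nonzero coefficient q(i, j) at x^i. *)
pose q1 : fps R := fun k l => q k (l + j)%N.
pose q2 : fps R := fun k l => if (l < j)%N then q k l else 0%R.
have yX : forall n (r : fps R) k l, (y ^+ n * r)%R k l = if (l < n)%N then 0%R else r k (l - n)%N.
  elim=> [|n IHn] r k l; first by rewrite expr0 mul1r subn0.
  by rewrite exprS -mulrA yME; case: l => [|l] //; rewrite IHn.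
have qE : q = (y ^+ j * q1 + q2)%R.
  apply: fpsP => k l; rewrite fpsDE yX /q1 /q2; case: ltnP => [_|le]; first by rewrite add0r.
  by rewrite addr0 subnK.
have compXn (n : nat) : (y ^+ n)%R ∘ A = (Y ^+ n)%R.
  by elim: n => [|n IHn]; rewrite ?expr0 ?comp1 // !exprS compM // IHn compY.
have le1 : nu ((y ^+ j * q1)%R ∘ A) <= (1 * i%:R + b * j%:R)%:E.
  rewrite compM // compXn valM // valX // nuY.
  have -> : (1 * i%:R + b * j%:R)%:E = j%:R%:E * b%:E + i%:R%:E.
    by rewrite -EFinM -EFinD; congr EFin; ring.
  by apply: leeD2l; apply: hle; rewrite coordVK /q1 add0n.
have lt2 : (1 * i%:R + b * j%:R)%:E < nu (q2 ∘ A).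
  have [->|/eqP q20] := eqVneq q2 0%R; first by rewrite comp0 val0 // ltry.
  have [k [l [q2kl h2]]] := leading_monomial ltr01 b0 q20.
  have : monoval 1 b ((q2 ∘ A) ∘ P) <= nu (q2 ∘ A).
    by apply: val_ge_mono => //; rewrite ?nuX ?nuY.
  rewrite coordVK (monovalE q2kl) => [|s t /h2[]//]; apply: lt_le_trans.
  move: q2kl; rewrite /q2; case: ltnP => [ltlj|_]; last by rewrite eqxx.
  move=> /h[w1 w2]; rewrite lte_fin lt_neqAle w1 andbT; apply/negP => /eqP e.
  by move: (w2 (esym e)); lia.
rewrite -[p]coordK -/q qE compD valD_lt //; exact: le_lt_trans lt2.
Qed.

End Val.

Lemma monoX (a b : R) : monoval a b (X ∘ P) = a%:E.
Proof.
rewrite coordXK (@monovalE _ _ _ _ 1%N 0%N) ?mulr1 ?mulr0 ?addr0 // /x_ /= ?oner_neq0 //.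
by move=> [|[|k]] [|l] /=; rewrite ?eqxx // mulr1 mulr0 addr0.
Qed.

Lemma monoY (a b : R) : monoval a b (Y ∘ P) = b%:E.
Proof.
rewrite coordYK (@monovalE _ _ _ _ 0%N 1%N) ?mulr1 ?mulr0 ?add0r // /y_ /= ?oner_neq0 //.
by move=> [|k] [|[|l]] /=; rewrite ?eqxx // mulr1 mulr0 add0r.
Qed.

Lemma valuation_mono (a b : R) : (1 <= a)%R -> (1 <= b)%R -> (a = 1 \/ b = 1)%R ->
  valuation (fun p => monoval a b (p ∘ P)).
Proof.
move=> a1 b1 ab; have a0 : (0 < a)%R by lra. have b0 : (0 < b)%R by lra.
have wt_ge0 i j : (0 <= a * i%:R + b * j%:R)%R.
  by rewrite addr_ge0 // mulr_ge0 // ltW.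
split=> [p|]; first by apply: monoval_ge => i j _; rewrite lee_fin.
split=> [p q|]; first by rewrite -monovalM // -compM.
split=> [p q|]; first by rewrite -[psadd _ _]/((p : fps R) + q)%R compD; apply: monovalD.
split; first by rewrite -[ps0 R]/(0%R : fps R) comp0 monoval0.
split=> [c c0|].
  rewrite -[psC c]/(cst c) comp_cst (@monovalE _ _ _ _ 0%N 0%N) ?mulr0 ?addr0 //.
split=> [p /inm1P hp|].
  apply: monoval_ge => i j pij; rewrite lee_fin.
  have : (0 < i + j)%N by rewrite lt0n; apply: contra pij => /eqP ij0; rewrite (inm_comp cP hp) // ij0.
  case: i {pij} => [|i] ij; last first.
    by have := ler0n R i; have := wt_ge0 i j; rewrite -natr1; nra.
  case: j ij => [//|j] _.
  by have := ler0n R j; have := wt_ge0 0%N j; rewrite -natr1; nra.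
case: ab => e; [exists X|exists Y]; split; rewrite ?monoX ?monoY ?e //.
  exact: X00.
exact: Y00.
Qed.

(** * Intersection multiplicity with Y as an order of vanishing *)

Lemma comp_sum f I (s : seq I) (Q : pred I) (F : I -> fps R) :
  ((\sum_(k <- s | Q k) F k) ∘ f = \sum_(k <- s | Q k) (F k ∘ f))%R.
Proof. exact: (big_morph (comp f) (compD f) (comp0 f)). Qed.

Lemma compXn f p n : centered f -> ((p ^+ n) ∘ f = (p ∘ f) ^+ n)%R.
Proof.
by move=> cf; elim: n => [|n IHn]; rewrite ?expr0 ?comp1 // !exprS compM // IHn.
Qed.

Lemma xnME n p i j : (x ^+ n * p)%R i j = if (i < n)%N then 0%R else p (i - n)%N j.
Proof.
elim: n p i j => [|n IHn] p i j; first by rewrite expr0 mul1r subn0.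
by rewrite exprS -mulrA xME; case: i => [|i] //; rewrite IHn.
Qed.

Lemma lincombE n (c : 'I_n -> C) (chis : 'I_n -> ps R) :
  (fun i j => \sum_(k < n) c k * chis k i j)%R =
  (\sum_(k < n) cst (c k) * (chis k : fps R))%R :> fps R.
Proof.
apply: fpsP => i j; rewrite fps_sumE; apply: eq_bigr => k _.
by rewrite (cstME (c k) (chis k)).
Qed.

(* The coefficients (p ∘ P) i 0 are those of the restriction of p to the curve
   {Y = 0}, with X as parameter. *)
Lemma restrYM q i : ((Y * q)%R ∘ P) i 0%N = 0%R.
Proof. by rewrite compM // coordYK yME. Qed.

Lemma restrXn k i : ((X ^+ k)%R ∘ P) i 0%N = ((i == k)%:R)%R.
Proof.
rewrite compXn // coordXK -[(x ^+ k)%R]mulr1 xnME /GRing.one /= /ps1 /psC andbT.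
case: ltnP => [lt|le]; first by rewrite ltn_eqF.
by rewrite subn_eq0 eqn_leq le andbT; case: leqP.
Qed.

Lemma restrM_lt p q n i : (forall k, (k < n)%N -> (p ∘ P) k 0%N = 0%R) -> (i < n)%N ->
  ((q * p)%R ∘ P) i 0%N = 0%R.
Proof.
move=> h lt; rewrite compM // fpsME big1 // => k _; rewrite big_ord1 h ?mulr0 //.
exact: leq_ltn_trans (leq_subr _ _) lt.
Qed.

(** When n is the exact order of p along the curve, [u] is a unit. *)
Lemma curve_division p n : (forall k, (k < n)%N -> (p ∘ P) k 0%N = 0%R) ->
  exists u q : fps R, p = (X ^+ n * u + Y * q)%R /\ u 0%N 0%N = (p ∘ P) n 0%N.
Proof.
move=> h; set Q := p ∘ P in h *.
pose U : fps R := fun i j => if j == 0%N then Q (i + n)%N 0%N else 0%R.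
pose V : fps R := fun i j => Q i j.+1.
exists (U ∘ A), (V ∘ A); split; last by rewrite comp_00.
rewrite -[LHS]coordK -/Q -{1}(compX cA) -{1}(compY cA) -compXn // -!compM // -compD.
congr (_ ∘ _); apply: fpsP => i j; rewrite fpsDE xnME yME /U /V.
case: ltnP => [lt|le]; first by rewrite add0r; case: j => //; rewrite h.
by case: j => [|j]; rewrite /= ?add0r // subnK // addr0.
Qed.

Lemma curve_divides p : (forall k, (p ∘ P) k 0%N = 0%R) -> exists q, p = (Y * q)%R.
Proof.
move=> h; exists ((fun i j => (p ∘ P) i j.+1 : C) ∘ A).
rewrite -[LHS]coordK -comp_y //; congr (_ ∘ _); apply: fpsP => i j.
by rewrite yME; case: j.
Qed.

Lemma indep_powers p n : (forall k, (k < n)%N -> (p ∘ P) k 0%N = 0%R) ->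
  indep_mod Y p (fun k : 'I_n => (X ^+ k)%R).
Proof.
move=> h c [a [b]]; rewrite lincombE => e k.
transitivity (((\sum_(l < n) cst (c l) * X ^+ l)%R ∘ P) k 0%N).
  rewrite comp_sum fps_sumE (bigD1 k) //= big1 ?addr0 => [|l lk].
    by rewrite compM // comp_cst cstME restrXn eqxx mulr1.
  rewrite compM // comp_cst cstME restrXn (_ : (k == l :> nat) = false) ?mulr0 //.
  by apply: negbTE; rewrite eq_sym.
rewrite e -[psadd _ _]/((a : fps R) * Y + (b : fps R) * p)%R compD fpsDE.
by rewrite mulrC restrYM add0r (restrM_lt _ h).
Qed.

Lemma indep_bound p n m (chis : 'I_m -> ps R) :
  (forall k, (k < n)%N -> (p ∘ P) k 0%N = 0%R) -> (p ∘ P) n 0%N != 0%R ->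
  indep_mod Y p chis -> (m <= n)%N.
Proof.
move=> h pn ind; rewrite leqNgt; apply/negP => ltnm.
(* With more than n series, some nontrivial combination has its first n coefficients along the curve
   equal to zero; it then lies in the ideal of X^n and Y, which is that of p and Y. *)
pose M : 'M[C]_(m, n) := (\matrix_(i, j) ((chis i : fps R) ∘ P) j 0%N)%R.
have : (kermx M != 0)%R.
  rewrite kermx_eq0 -row_leq_rank -ltnNge.
  exact: leq_ltn_trans (rank_leq_col M) ltnm.
move=> /rowV0Pn[c /sub_kermxP cM c0]; case/negP: c0; apply/eqP/rowP => k.
rewrite mxE; apply: (ind (fun k => c 0%R k)); rewrite lincombE.
set chi : fps R := (\sum_(k < m) _)%R.
have chi0 i : (i < n)%N -> (chi ∘ P) i 0%N = 0%R.
  move=> lt; have /matrixP/(_ 0%R (Ordinal lt)) := cM; rewrite !mxE => <-.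
  rewrite comp_sum fps_sumE; apply: eq_bigr => l _.
  by rewrite compM // comp_cst cstME mxE.
have [u [q [pE u0]]] := curve_division h.
have [u' [q' [chiE _]]] := curve_division chi0.
have [w uw] : exists w : fps R, (u * w = 1)%R by apply: inv_ex; rewrite u0.
(* Obtained by substituting X^n = w (p - Y q) into chi = X^n u' + Y q'. *)
exists (q' - q * w * u')%R, (w * u')%R.
rewrite -[psadd _ _]/((q' - q * w * u') * Y + (w * u') * p)%R pE chiE.
transitivity (X ^+ n * ((u * w) * u') + Y * q')%R; first by rewrite uw mul1r.
have alg (t u1 w1 v b r1 r2 : fps R) : (t * ((u1 * w1) * v) + b * r1 =
  (r1 - r2 * w1 * v) * b + (w1 * v) * (t * u1 + b * r2))%R by ring.
exact: alg.
Qed.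

Lemma multY : mult Y = 1. Proof. exact: mult_smooth Y00 smoothY. Qed.

Lemma irreducibleY : ps_irreducible Y.
Proof. exact: smooth_irreducible Y00 smoothY. Qed.

Lemma curvevalE p : curveval Y p = intmult Y p.
Proof. by rewrite /curveval multY /= invr1 mule1. Qed.

Lemma curveval_ord p n : (forall k, (k < n)%N -> (p ∘ P) k 0%N = 0%R) ->
  (p ∘ P) n 0%N != 0%R -> curveval Y p = n%:R%:E.
Proof.
move=> h pn; rewrite curvevalE; apply/eqP; rewrite eq_le; apply/andP; split.
  apply: ge_ereal_sup => _ [m [chis [ind ->]]]; rewrite lee_fin ler_nat.
  exact: indep_bound ind.
by apply: ereal_sup_ubound; exists n, (fun k : 'I_n => (X ^+ k)%R); split=> //; apply: indep_powers.
Qed.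

Lemma curveval_oo p : (forall k, (p ∘ P) k 0%N = 0%R) -> curveval Y p = +oo.
Proof.
move=> h; rewrite curvevalE; apply/eqyP => r r0.
apply: (@le_trans _ _ (Num.truncn r).+1%:R%:E).
  by rewrite lee_fin ltW // truncnS_gt.
apply: ereal_sup_ubound; exists (Num.truncn r).+1, (fun k => (X ^+ k)%R).
by split=> //; apply: indep_powers.
Qed.

Lemma restr_cases p : (forall k, (p ∘ P) k 0%N = 0%R) \/
  exists2 n, (forall k, (k < n)%N -> (p ∘ P) k 0%N = 0%R) & (p ∘ P) n 0%N != 0%R.
Proof.
have [[n pn]|h] := pselect (exists n, (p ∘ P) n 0%N != 0%R); last first.
  by left=> k; apply/eqP/negPn/negP => pk; apply: h; exists k.
right; have ex : exists n, (p ∘ P) n 0%N != 0%R by exists n.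
have [m pm mmin] := ex_minnP ex; exists m => // k lt.
by apply/eqP/negPn/negP => /mmin; rewrite leqNgt lt.
Qed.

Lemma curveval_eqoo p : curveval Y p = +oo -> exists q, p = (Y * q)%R.
Proof.
by have [/curve_divides|[n h pn]] := restr_cases p; rewrite ?(curveval_ord h pn).
Qed.

Lemma curvevalY q : curveval Y (Y * q)%R = +oo.
Proof. by apply: curveval_oo => k; rewrite restrYM. Qed.

Lemma curveval_le p i : (p ∘ P) i 0%N != 0%R -> curveval Y p <= i%:R%:E.
Proof.
move=> pi; have [h|[n h pn]] := restr_cases p; first by rewrite h eqxx in pi.
rewrite (curveval_ord h pn) lee_fin ler_nat leqNgt.
by apply: contra pi => /h ->.
Qed.

(** The order along the curve becomes the multiplicity of a series in x alone, so that the valuation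
    axioms follow from those of [monoval]. *)
Lemma curveval_monoval p : curveval Y p = monoval 1 1 ((p ∘ P) ∘ (x, 0%R)).
Proof.
have [h|[n h pn]] := restr_cases p.
  rewrite curveval_oo // -(@monoval0 R 1 1); congr monoval.
  by apply: fpsP => i j; rewrite comp_x0E h if_same.
rewrite (curveval_ord h pn) (@monovalE _ _ _ _ n 0%N) ?comp_x0E //.
  by rewrite mul1r mulr0 addr0.
move=> k l; rewrite comp_x0E.
case: (eqVneq l 0%N) => [->|_]; last by rewrite eqxx.
move=> pk; rewrite !mulr0 !addr0 !mul1r ler_nat leqNgt.
by apply: contra pk => /h ->.
Qed.

Lemma curvevalX : curveval Y X = 1.
Proof.
rewrite (@curveval_ord _ 1%N) //; last by rewrite coordXK /x_ oner_neq0.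
by case=> // _; rewrite coordXK.
Qed.

Lemma intmultXY : intmult Y X = 1. Proof. by rewrite -curvevalE curvevalX. Qed.

Lemma valuation_curveval : valuation (curveval Y).
Proof.
have cZ : centered (x, 0%R : fps R) by apply: centered_pair; [apply: inm_x|].
have cE : curveval Y = fun p => monoval 1 1 ((p ∘ P) ∘ (x, 0%R)).
  by apply/funext => p; rewrite curveval_monoval.
rewrite cE; split=> [p|].
  by apply: monoval_ge => i j _; rewrite lee_fin addr_ge0 // mulr_ge0.
split=> [p q|]; first by rewrite -monovalM // -!compM.
split=> [p q|]; first by rewrite -[psadd _ _]/((p : fps R) + q)%R !compD; apply: monovalD.
split; first by rewrite -[ps0 R]/(0%R : fps R) !comp0 monoval0.
split=> [c c0|].
  rewrite -[psC c]/(cst c) !comp_cst (@monovalE _ _ _ _ 0%N 0%N) ?mulr0 ?addr0 //.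
split=> [p /inm1P hp|]; last first.
  by exists X; split; [exact: X00|rewrite -curveval_monoval curvevalX].
apply: monoval_ge => i j pij; rewrite lee_fin !mul1r -natrD ler1n lt0n.
apply: contra pij => /eqP ij0; rewrite (inm_comp cZ (inm_comp cP hp)) //.
by rewrite ij0.
Qed.

(** Normalization forces nu(X) = 1, and a series not divisible by Y is X^n times a unit plus a
    multiple of Y, whose value is infinite. *)
Lemma val_eq_curveval nu : valuation nu -> nu Y = +oo -> nu = curveval Y.
Proof.
move=> vnu nuY; apply/funext => p.
have nuX : nu X = 1 by apply: val_X1 => //; rewrite nuY ltry.
have Yoo q : nu (Y * q)%R = +oo.
  by rewrite valM // nuY addye // -ltNye (lt_le_trans _ (val_ge0 vnu q)).
have [h|[n h pn]] := restr_cases p.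
  by rewrite curveval_oo //; have [q ->] := curve_divides h.
rewrite (curveval_ord h pn); have [u [q [pE u0]]] := curve_division h.
have e : nu (X ^+ n * u)%R = n%:R%:E.
  have nuu : nu u = 0 by apply: (val_unit vnu); rewrite u0.
  by rewrite (valM vnu) (valX vnu) nuX mule1 nuu adde0.
by rewrite pE valD_lt // e Yoo ltry.
Qed.

End Coordinates.

(** * The segment below a curve valuation, and the action of f *)

Section CurveSegment.
Variable R : realType.
Local Notation C := R[i].
Implicit Types (p q r : fps R) (nu mu w : fps R -> \bar R).
Local Notation x := (x_ R).
Local Notation y := (y_ R).
Local Notation id_ := (id_ R).
Local Open Scope ereal_scope.

Lemma val_fin nu p : valuation nu -> nu p <> +oo ->
  exists2 s : R, (0 <= s)%R & nu p = s%:E.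
Proof.
move=> vnu; case e : (nu p) => [s| |] // _; have := val_ge0 vnu p; rewrite e //.
by rewrite lee_fin => s0; exists s.
Qed.

Variables A P : germ R.
Hypotheses (aA : autom A) (aP : autom P).
Hypotheses (PA : gcomp P A = id_) (AP : gcomp A P = id_).
Local Notation X := (fst_ A).
Local Notation Y := (snd_ A).
Local Notation nuC := (curveval Y).

Definition segval (s : R) : fps R -> \bar R := fun p => monoval 1 s (p ∘ P).

Lemma segvalY s : segval s Y = s%:E. Proof. exact: monoY. Qed.

Lemma valuation_segval s : (1 <= s)%R -> valuation (segval s).
Proof. by move=> s1; apply: (valuation_mono aA aP AP) => //; left. Qed.

Lemma segval_le s nu : valuation nu -> (1 <= s)%R -> s%:E <= nu Y -> vle (segval s) nu.
Proof.
by move=> vnu s1 sY p; apply: (val_ge_mono aA aP PA vnu) => //; apply: val_X_ge1.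
Qed.

Let valC : valuation nuC := valuation_curveval aA aP PA AP.

Lemma curveval_gen : nuC Y = +oo.
Proof. by rewrite -{2}[Y]mulr1 (curvevalY aA aP AP). Qed.

Lemma segval_lt_curve s : (1 <= s)%R -> vlt (segval s) nuC.
Proof.
move=> s1; split; first by apply: segval_le => //; rewrite curveval_gen leey.
by move=> /(congr1 (fun nu => nu Y)); rewrite segvalY curveval_gen.
Qed.

Lemma below_curve w s : valuation w -> vle w nuC -> w Y = s%:E -> w = segval s.
Proof.
move=> vw le wY; have s1 : (1 <= s)%R by rewrite -lee_fin -wY val_Y_ge1.
apply/funext => p; apply/eqP; rewrite eq_le; apply/andP; split.
  apply: (val_le_mono aA aP PA AP vw) => // q i qi.
  exact: le_trans (le q) (curveval_le aA aP PA AP qi).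
by apply: segval_le => //; rewrite wY.
Qed.

(** Anything below nu_C is some [segval t], and lying below nu as well amounts to t <= s. The
    infimum thus depends on nu(Y) only, which turns the sets [inU] into conditions nu(Y) > s. *)
Lemma inf_curve nu s : valuation nu -> nu Y = s%:E -> is_inf (segval s) nu nuC.
Proof.
move=> vnu nuY; have s1 : (1 <= s)%R by rewrite -lee_fin -nuY val_Y_ge1.
split; first exact: valuation_segval.
split; first by apply: segval_le => //; rewrite nuY.
split; first by case: (segval_lt_curve s1).
move=> w vw wnu wC; have wYs := wnu Y; rewrite nuY in wYs.
have [|t t0 wY] := @val_fin w Y vw; first by move=> e; rewrite e in wYs.
rewrite (below_curve vw wC wY); rewrite wY in wYs.
apply: segval_le; rewrite ?segvalY //; first exact: valuation_segval.
by rewrite -lee_fin -wY val_Y_ge1.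
Qed.

Lemma curve_end : is_end nuC.
Proof.
split=> // mu vmu le; apply: (val_eq_curveval aA aP PA AP vmu).
by apply/eqP; rewrite -leye_eq -curveval_gen; apply: le.
Qed.

Lemma inU_segval s nu : (1 <= s)%R -> valuation nu -> s%:E < nu Y ->
  inU nuC (segval s) nu.
Proof.
move=> s1 vnu lt; split=> //.
have [nuY|nuY] := pselect (nu Y = +oo).
  rewrite (val_eq_curveval aA aP PA AP vnu nuY); exists nuC; split.
    have refl : vle nuC nuC by move=> p; apply: lexx.
    by split=> //; split=> //; split.
  exact: segval_lt_curve.
have [t t0 e] := val_fin vnu nuY; exists (segval t); split; first exact: inf_curve.
rewrite e lte_fin in lt; have t1 : (1 <= t)%R by lra.
split.
  by apply: segval_le => //; [exact: valuation_segval|rewrite segvalY lee_fin ltW].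
move=> /(congr1 (fun nu => nu Y)); rewrite !segvalY => -[] st.
by rewrite st ltxx in lt.
Qed.

Lemma lt_curve_fin w : valuation w -> vlt w nuC ->
  exists2 s : R, (1 <= s)%R & w Y = s%:E.
Proof.
move=> vw [le ne]; have [|s s0 wY] := @val_fin w Y vw.
  by move/(val_eq_curveval aA aP PA AP vw).
by exists s; rewrite // -lee_fin -wY val_Y_ge1.
Qed.

Lemma inU_lt nu0 nu : valuation nu0 -> vlt nu0 nuC -> inU nuC nu0 nu -> nu0 Y < nu Y.
Proof.
move=> v0 lt0 [vnu [m [[vm [mnu [mC _]]] [le0 ne0]]]].
have [s s1 e0] := lt_curve_fin v0 lt0.
apply: lt_le_trans (mnu Y); rewrite e0.
have [mY|mY] := pselect (m Y = +oo); first by rewrite mY ltry.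
have [t t0 mYt] := val_fin vm mY; rewrite mYt.
have := le0 Y; rewrite e0 mYt => st; rewrite lt_neqAle st andbT.
apply/eqP => -[] est; apply: ne0; rewrite (below_curve v0 lt0.1 e0).
by rewrite (below_curve vm mC mYt) est.
Qed.

End CurveSegment.

(** * Charts of modifications and finiteness of quasimonomial valuations *)

Section Charts.
Variable R : realType.
Local Notation C := R[i].
Implicit Types (p q r : fps R) (nu mu w : fps R -> \bar R).
Local Notation x := (x_ R).
Local Notation y := (y_ R).
Local Notation id_ := (id_ R).

Lemma blowup_chartE : blowup_chart R = (x, x * y).
Proof.
rewrite /blowup_chart; congr pair; apply: fpsP => i j.
  by rewrite /x_; case: ifP.
by rewrite xME /y_; case: i => [|i] //=; rewrite eqSS; case: ifP.
Qed.

Lemma comp_blowupE p i j :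
  (p ∘ (x, x * y)) i j = if (j <= i)%N then p (i - j)%N j else 0.
Proof.
pose S q : fps R := fun i j => if (j <= i)%N then q (i - j)%N j else 0.
have cf : centered (x, x * y).
  by apply: centered_pair; [apply: inm_x|apply: inmMl; apply: inm_y].
suff -> : p ∘ (x, x * y) = S p by [].
apply/eqP; rewrite -subr_eq0; apply/eqP; move: p.
apply: (inm_coind (D1 := @divx R) (D2 := @divy R) cf.1 cf.2) => p.
have -> : S p = cst (p 0%N 0%N) + x * S (divx p) + x * y * S (divy p).
  apply: fpsP => k l; rewrite !fpsDE -mulrA !xME.
  case: k => [|k]; first by case: l => [|l]; rewrite /S /cst /psC /= ?addr0.
  rewrite yME /S /divx /divy /cst /psC /= add0r.
  case: l => [|l]; first by rewrite !subn0 addr0.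
  rewrite subSS ltnS subn_eq0; case: (ltngtP l k) => [lt|gt|->].
  - by rewrite subnSK // addr0.
  - by rewrite addr0.
  - by rewrite add0r subnn.
by rewrite (comp_split _ cf) /fst_ /snd_ /=; ring.
Qed.

(** The blow-up sends x^i y^j to x^(i+j) y^j, which is injective on exponents, and coordinate
    changes are invertible. *)
Lemma mod_chart_inj (P : germ R) : mod_chart P ->
  centered P /\ forall p, p ∘ P = 0 -> p = 0.
Proof.
have autom_inj A p : autom A -> p ∘ A = 0 -> p = 0.
  move=> aA e; have [B [aB [_ AB]]] := autom_inv aA.
  rewrite -[p]comp_id -AB -compA ?e ?comp0 //; exact: autom_centered.
have cb : centered (blowup_chart R).
  rewrite blowup_chartE; apply: centered_pair; first exact: inm_x.
  by apply: inmMl; apply: inm_y.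
elim=> [A aA|{}P A _ [cP injP] aA].
  by split=> [|p]; [apply: autom_centered|apply: autom_inj].
have cA := autom_centered aA.
rewrite -[mapcomp P _]/(gcomp P (gcomp (blowup_chart R) A)); split.
  by apply: centered_gcomp => //; apply: centered_gcomp.
move=> p; rewrite -compA // -?compA //; last exact: centered_gcomp.
move=> /(autom_inj _ _ aA); rewrite blowup_chartE => e; apply: injP.
apply: fpsP => i j; rewrite fps0E.
have := congr1 (fun r : fps R => r (i + j)%N j) e.
by rewrite comp_blowupE leq_addl addnK.
Qed.

Lemma quasimonomial_fin nu p : quasimonomial nu -> p <> 0 -> nu p <> +oo%E.
Proof.
move=> [P [a [b [mP [a0 [b0 nuE]]]]]] p0; rewrite nuE.
have [cP inj] := mod_chart_inj mP.
have [i [j ij]] : exists i j, (p ∘ P) i j != 0.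
  apply: contrapT => h; apply: p0; apply: inj; apply: fpsP => i j.
  by apply/eqP/negPn/negP => pij; apply: h; exists i, j.
by move=> e; have := monoval_le a b ij; rewrite [monoval _ _ _]e.
Qed.

End Charts.

(** * Existence of the pushforward of a valuation *)

Section Push.
Variable R : realType.
Local Notation C := R[i].
Implicit Types (p q r : fps R) (nu mu w : fps R -> \bar R).
Local Notation x := (x_ R).
Local Notation y := (y_ R).
Local Open Scope ereal_scope.
Variable f : germ R.
Hypothesis cf : centered f.

Lemma cfn_le nu p : valuation nu -> inm 1 p -> cfn f nu <= nu (p ∘ f).
Proof.
move=> vnu hp; rewrite (comp_split _ cf) hp // cst0 add0r.
apply: (valD_ge vnu); rewrite (valM vnu).
  by rewrite (@le_trans _ _ (nu (fst_ f))) ?leeDl ?val_ge0 // ge_min lexx.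
by rewrite (@le_trans _ _ (nu (snd_ f))) ?leeDl ?val_ge0 // ge_min lexx orbT.
Qed.

Lemma cfn_ge1 nu : valuation nu -> 1 <= cfn f nu.
Proof.
by move=> vnu; rewrite le_min (val_inm vnu cf.1) (val_inm vnu cf.2).
Qed.

Lemma cfn_fin nu : valuation nu -> cfn f nu <> +oo ->
  exists2 c : R, (1 <= c)%R & cfn f nu = c%:E.
Proof.
move=> vnu; have := cfn_ge1 vnu; case: (cfn f nu) => [c| |] //.
by rewrite lee_fin; exists c.
Qed.

Lemma push_fin nu mu p : push f nu mu -> cfn f nu <> +oo ->
  mu p = nu (p ∘ f) * ((fine (cfn f nu))^-1)%:E.
Proof. by case=> _ [[_ ->]|[-> _]]. Qed.

Lemma push_ex nu : valuation nu -> cfn f nu <> +oo -> exists mu, push f nu mu.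
Proof.
move=> vnu cfin; exists (fun p => nu (p ∘ f) * ((fine (cfn f nu))^-1)%:E).
split; last by left; split.
have [c c1 ce] := cfn_fin vnu cfin; rewrite ce /=.
have k0 : (0 < c^-1)%R by rewrite invr_gt0; lra.
have kE : c%:E * (c^-1)%:E = 1 :> \bar R.
  by rewrite -EFinM divff // gt_eqF //; lra.
have k0' : 0 <= (c^-1)%:E :> \bar R by rewrite lee_fin ltW.
split=> [p|]; first by rewrite mule_ge0 // val_ge0.
split=> [p q|].
  by rewrite -[psmul p q]/((p : fps R) * (q : fps R))%R compM // valM // ge0_muleDl ?val_ge0.
split=> [p q|].
  rewrite -[psadd p q]/((p : fps R) + (q : fps R))%R compD ge_min.
  have := valD vnu (comp f p) (comp f q); rewrite ge_min => /orP[h|h]; apply/orP; [left|right];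
    exact: lee_wpmul2r.
split; first by rewrite -[ps0 R]/(0%R : fps R) comp0 val0 // gt0_mulye.
split=> [d d0|]; first by rewrite -[psC d]/(cst d) comp_cst val_cst // mul0e.
split=> [p /inm1P hp|]; first by rewrite -kE -ce; apply: lee_wpmul2r => //; apply: cfn_le.
(* Normalization: the minimum c is reached at f_1 = x ∘ f or f_2 = y ∘ f, so x or y has value 1. *)
have [e|e] : nu (fst_ f) = c%:E \/ nu (snd_ f) = c%:E.
  by move: ce; rewrite /cfn /Order.min; case: ifP => _ ->; [left|right].
  by exists x; split; rewrite ?compX ?e //; apply/inm1P/inm_x.
by exists y; split; rewrite ?compY ?e //; apply/inm1P/inm_y.
Qed.

End Push.

(** * The dynamics in invariant coordinates *)

Lemma curveval_unit (R : realType) (p u : fps R) : u 0%N 0%N != 0 ->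
  mult p = 1%E -> mult (p * u : fps R) = 1%E -> curveval (p * u : fps R) = curveval p.
Proof.
move=> u0 mp mpu; apply/funext => q; rewrite /curveval mp mpu.
suff e chi : in_ideal2 (p * u : fps R) q chi <-> in_ideal2 p q chi.
  congr (_ * _)%E; rewrite /intmult; congr ereal_sup; apply/seteqP.
  by split=> z [n [chis [ind ->]]]; exists n, chis; split=> // c hc; apply: ind;
    apply/e.
have [v uv] := inv_ex u0; split=> -[c [d ->]].
  exists ((c : fps R) * u), d; rewrite -[psmul c _]/((c : fps R) * (p * u))%R.
  by rewrite -[psmul (_ * u) p]/((c : fps R) * u * p)%R; congr (psadd _ _); rewrite mulrCA mulrC.
exists ((c : fps R) * v), d; congr (psadd _ _).
rewrite -[RHS]/((c : fps R) * v * (p * u))%R -[LHS]/((c : fps R) * p)%R.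
by rewrite -mulrA [v * _]mulrC -mulrA uv mulr1.
Qed.

Section Dynamics.
Variable R : realType.
Local Notation C := R[i].
Implicit Types (p q r : fps R) (nu mu w : fps R -> \bar R).
Local Notation x := (x_ R).
Local Notation y := (y_ R).
Local Notation id_ := (id_ R).
Local Open Scope ereal_scope.

Variable f : germ R.
Hypothesis cf : centered f.

(* Since nu(Y o f) = nu(Y) and c(f, nu) >= 1, the value nu(Y) never increases, so
   orbits cannot converge to the curve valuation, which has nu(Y) = +oo. *)
Lemma unit_axis_not_attracting (A : germ R) (u : fps R) : autom A ->
  snd_ A ∘ f = (snd_ A * u)%R -> u 0%N 0%N != 0%R -> ~ attracting f (curveval (snd_ A)).
Proof.
move=> aA fY u0 [nu0 [v0 [lt0 [hpush [hinU [_ hcvg]]]]]].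
have [P [aP [PA AP]]] := autom_inv aA.
have [s s1 e0] := lt_curve_fin aA aP PA AP v0 lt0.
have nu0E : nu0 = segval P s by exact: (below_curve aA aP PA AP v0 lt0.1 e0).
have s1' : (1 <= s + 1)%R by lra.
have step nu : inU (curveval (snd_ A)) nu0 nu ->
    exists mu, push f nu mu /\ inU (curveval (snd_ A)) nu0 mu.
  by move=> hU; have [mu pmu] := hpush _ hU; exists mu; split=> //; apply: hinU pmu.
(* An orbit has to be exhibited, and [push] is a relation, so an image inside U is chosen. The
   default value is never met, as the orbit starts in U and stays there. *)
pose next nu := if pselect (inU (curveval (snd_ A)) nu0 nu) is left h
  then projT1 (cid (step nu h)) else nu.
have nextP nu : inU (curveval (snd_ A)) nu0 nu ->
    push f nu (next nu) /\ inU (curveval (snd_ A)) nu0 (next nu).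
  by move=> h; rewrite /next; case: pselect => // h'; case: cid.
pose orb n := iter n next (segval P (s + 1)%R).
have orbU n : inU (curveval (snd_ A)) nu0 (orb n).
  elim: n => [|n IHn]; last by case: (nextP _ IHn).
  rewrite nu0E; apply: (inU_segval aA aP PA AP) => //; first exact: (valuation_segval aA aP AP).
  by rewrite /orb /= (segvalY AP) lte_fin ltrDl.
have bound n : orb n (snd_ A) <= (s + 1)%:E.
  elim: n => [|n IHn]; first by rewrite /orb /= (segvalY AP).
  have vn : valuation (orb n) by case: (orbU n).
  have ule : cfn f (orb n) <= (s + 1)%:E.
    apply: le_trans (cfn_le cf vn (autom_centered aA).2) _.
    by rewrite fY (valM vn) (val_unit vn u0) adde0.
  have cne : cfn f (orb n) <> +oo by move=> e; rewrite e in ule.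
  have [c c1 ce] := cfn_fin cf vn cne.
  rewrite -[orb n.+1]/(next (orb n)).
  rewrite (push_fin _ (nextP _ (orbU n)).1 cne) ce /= fY (valM vn) (val_unit vn u0) // adde0.
  apply: le_trans IHn; rewrite -[leRHS]mule1; apply: lee_wpmul2l; first exact: val_ge0.
  by rewrite lee_fin invf_le1 //; lra.
have := hcvg orb (orbU 0%N) (fun n => (nextP _ (orbU n)).1) (snd_ A).
rewrite (curveval_gen aA aP AP) => /cvgeyPgt/(_ (s + 1)%R) [N _ /(_ N (leqnn N))] /=.
by rewrite ltNge bound.
Qed.

Variables (A P : germ R) (a b : fps R).
Hypotheses (aA : autom A) (aP : autom P).
Hypotheses (PA : gcomp P A = id_) (AP : gcomp A P = id_).
Local Notation X := (fst_ A).
Local Notation Y := (snd_ A).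
Hypotheses (fX : X ∘ f = (X * a)%R) (fY : Y ∘ f = (Y * b)%R).
Hypotheses (a0 : a 0%N 0%N != 0%R) (b0 : b 0%N 0%N = 0%R).
Local Notation nuC := (curveval Y).

Let cA : centered A := autom_centered aA.
Let valC : valuation nuC := valuation_curveval aA aP PA AP.

(** X and Y generate m, so X ∘ f = X a and Y ∘ f = Y b generate the ideal f^*m, on which c(f, nu) is
    the least value of nu. *)
Lemma cfnE nu : valuation nu -> cfn f nu = Order.min (nu X) (nu Y + nu b).
Proof.
move=> vnu; have eX : nu (X ∘ f) = nu X by rewrite fX (valM vnu) (val_unit vnu a0) adde0.
have eY : nu (Y ∘ f) = nu Y + nu b by rewrite fY (valM vnu).
rewrite -eX -eY; apply/eqP; rewrite eq_le le_min (cfn_le cf vnu cA.1) (cfn_le cf vnu cA.2) /=.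
have ge p : inm 1 p -> Order.min (nu (X ∘ f)) (nu (Y ∘ f)) <= nu (p ∘ f).
  move=> /(max_ideal_gen aA aP PA)[q [r ->]]; rewrite compD !compM //.
  apply: (valD_ge vnu); rewrite (valM vnu) ge_min.
    by rewrite leeDl ?val_ge0.
  by rewrite leeDl ?orbT ?val_ge0.
have := ge x (inm_x R); have := ge y (inm_y R); rewrite compX // compY // => h2 h1.
by rewrite /cfn le_min h1 h2.
Qed.

Lemma val_b_ge1 nu : valuation nu -> 1 <= nu b.
Proof. by move=> vnu; apply: (val_inm vnu); apply/inm1P. Qed.

Lemma cfn_eq1 nu : valuation nu -> 1 < nu Y -> cfn f nu = 1.
Proof.
move=> vnu lt; rewrite (cfnE vnu) (val_X1 aA aP PA vnu lt) min_l //.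
by rewrite (le_trans (ltW lt)) // leeDl ?val_ge0.
Qed.

Lemma push_val nu mu p : valuation nu -> 1 < nu Y -> push f nu mu -> mu p = nu (p ∘ f).
Proof.
move=> vnu lt pm; have c1 := cfn_eq1 vnu lt.
by rewrite (push_fin _ pm) c1 //= invr1 mule1.
Qed.

Lemma push_Y nu mu : valuation nu -> 1 < nu Y -> push f nu mu -> mu Y = nu Y + nu b.
Proof. by move=> vnu lt pm; rewrite (push_val _ vnu lt pm) fY (valM vnu). Qed.

Lemma fixed_curve : fixed f nuC.
Proof.
split=> //; have Yoo := curveval_gen aA aP AP.
have lt : 1 < nuC Y by rewrite Yoo ltry.
have [|mu pm] := push_ex cf valC; first by rewrite (cfn_eq1 valC lt).
suff e : mu = nuC by move: pm; rewrite e.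
apply: (val_eq_curveval aA aP PA AP); first by case: pm.
by rewrite (push_Y valC lt pm) Yoo addye // -ltNye (lt_le_trans _ (val_b_ge1 valC)) ?ltNyr.
Qed.

Lemma fixed_cases nu : fixed f nu -> nu = nuC \/ nu X = +oo.
Proof.
move=> [vnu pm]; have [|nuX] := pselect (nu X = +oo); [by right|left].
apply: (val_eq_curveval aA aP PA AP) => //.
have [s s0 e] := val_fin vnu nuX.
have cle : cfn f nu <= s%:E by rewrite (cfnE vnu) e ge_min lexx.
have cne : cfn f nu <> +oo by move=> e'; rewrite e' in cle.
have [c c1 ce] := cfn_fin cf vnu cne.
have s1 : (1 <= s)%R by rewrite -lee_fin -e val_X_ge1.
have := push_fin X pm cne; rewrite fX (valM vnu) (val_unit vnu a0) // adde0 e ce /=.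
rewrite -EFinM => -[] es.
have c_eq1 : c = 1%R.
  by move: es => /eqP; rewrite eq_sym mulrC -subr_eq0 -{2}[s]mul1r -mulrBl mulf_eq0
    subr_eq0 invr_eq1 => /orP[/eqP//|/eqP s00]; lra.
apply: contrapT => nuY; have [t t0 et] := val_fin vnu nuY.
have := push_fin Y pm cne; rewrite ce c_eq1 /= invr1 mule1 fY (valM vnu) et => eb.
have := val_b_ge1 vnu; move: eb; case: (nu b) => [v| |] //=; rewrite -EFinD lee_fin => -[].
lra.
Qed.

Lemma attracting_curve : attracting f nuC.
Proof.
(* With both weights equal to 1 this is the multiplicity valuation, the root of the tree. *)
exists (segval P 1); split; first exact: (valuation_segval aA aP AP).
split; first exact: (segval_lt_curve aA aP PA AP).
have v1 : valuation (segval P 1) by apply: (valuation_segval aA aP AP).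
have lt1 : vlt (segval P 1) nuC by apply: (segval_lt_curve aA aP PA AP).
have inUE nu : inU nuC (segval P 1) nu <-> valuation nu /\ 1 < nu Y.
  split=> [h|[vnu lt]]; last exact: (inU_segval aA aP PA AP).
  by split; [case: h|rewrite -(segvalY AP); apply: (inU_lt aA aP PA AP)].
have pushY nu mu : valuation nu -> 1 < nu Y -> push f nu mu -> nu Y + 1 <= mu Y.
  by move=> vnu lt pm; rewrite (push_Y vnu lt pm) leeD2l // val_b_ge1.
split=> [nu /inUE[vnu lt]|].
  by apply: (push_ex cf vnu); rewrite (cfn_eq1 vnu lt).
split=> [nu mu /inUE[vnu lt] pm|].
  apply/inUE; split; first by case: pm.
  have h := pushY _ _ vnu lt pm.
  by apply: (lt_le_trans lt); apply: (le_trans _ h); rewrite leeDl.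
split.
  have h2 : (1 <= 3 / 2 :> R)%R by lra.
  (* Images of points of U have value above 2 at Y, so any parameter in ]1, 2] gives a point of U
     that is not an image. *)
  exists (segval P (3 / 2)); split.
    apply/inUE; split; first exact: (valuation_segval aA aP AP).
    by rewrite (segvalY AP) lte_fin; lra.
  move=> nu /inUE[vnu lt] /(pushY _ _ vnu lt); rewrite (segvalY AP) => h.
  by have := le_trans (leeD2r 1 (ltW lt)) h; rewrite -EFinD lee_fin; lra.
move=> orb /inUE[vorb0 lt0] porb p.
have vorb n : valuation (orb n) by case: n => // n; case: (porb n).
have orbY n : 1 < orb n Y /\ n%:R%:E <= orb n Y.
  elim: n => [|n [IH1 IH2]]; first by split=> //; apply: val_ge0.
  have h := pushY _ _ (vorb n) IH1 (porb n); split.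
    by apply: (lt_le_trans IH1); apply: (le_trans _ h); rewrite leeDl.
  by apply: (le_trans _ h); rewrite -natr1 EFinD leeD2r.
have YqE n q : n%:R%:E <= orb n (Y * q)%R.
  by rewrite (valM (vorb n)); apply: (le_trans (orbY n).2); apply/leeDl/val_ge0.
have [h|[m h pm]] := restr_cases P p.
  have [q ->] := curve_divides aA aP PA h; rewrite (curvevalY aA aP AP).
  apply/cvgeyPge => M; exists (Num.truncn M).+1 => // n /= le.
  apply: le_trans (YqE n q); rewrite lee_fin.
  by apply: le_trans (ltW (truncnS_gt M)) _; rewrite ler_nat.
have [u [q [pE u0]]] := curve_division aA aP PA h.
rewrite (curveval_ord aA aP PA AP h pm); apply: cvg_near_cst.
(* After m + 1 steps the multiple of Y has value above m, so X^m u alone decides and the sequence is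
   constant. *)
exists m.+1 => // n /= lt.
have e : orb n (X ^+ m * u)%R = m%:R%:E.
  have uu : orb n u = 0 by apply: (val_unit (vorb n)); rewrite u0.
  rewrite (valM (vorb n)) (valX (vorb n)) uu adde0.
  by rewrite (val_X1 aA aP PA (vorb n) (orbY n).1) mule1.
rewrite pE (valD_lt (vorb n)) e //; apply: lt_le_trans (YqE n q).
by rewrite lte_fin ltr_nat.
Qed.

Lemma eigenvaluation_curve : eigenvaluation f nuC.
Proof.
split; first exact: fixed_curve.
right; split; last exact: attracting_curve.
exact: (curve_end aA aP PA AP).
Qed.

Lemma contracted_axis q : b = (X * q)%R -> contracted f X.
Proof.
move=> bE; split; first exact: smooth_irreducible (X00 aA) (smoothX aA).
have div p : inm 1 p -> exists r, (p ∘ f = X * r)%R.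
  move=> /(max_ideal_gen aA aP PA)[r [r' ->]]; rewrite compD !compM // fX fY bE.
  exists (a * (r ∘ f) + Y * q * (r' ∘ f))%R.
  by set r1 := r ∘ f; set r2 := r' ∘ f; move: (X : fps R) (Y : fps R) => X1 Y1; ring.
split; first by have [r] := div x (inm_x R); rewrite compX // => e; exists r.
by have [r] := div y (inm_y R); rewrite compY // => e; exists r.
Qed.

(** Dividing both components of f, psi divides X ∘ f = X a, hence X since a is a unit; and X is
    irreducible. *)
Lemma contracted_eq psi : contracted f psi ->
  exists2 u : fps R, u 0%N 0%N != 0%R & psi = (X * u)%R.
Proof.
move=> [[psi00 [psi0 irr]] [[q1 e1] [q2 e2]]].
have [c ac] := inv_ex a0.
have XE : X = ((psi : fps R) * ((divx X ∘ f) * q1 + (divy X ∘ f) * q2) * c)%R.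
  have : X ∘ f = ((psi : fps R) * ((divx X ∘ f) * q1 + (divy X ∘ f) * q2))%R.
    rewrite (comp_split _ cf) (X00 aA) cst0 add0r.
    have -> : fst_ f = ((psi : fps R) * (q1 : fps R))%R by [].
    have -> : snd_ f = ((psi : fps R) * (q2 : fps R))%R by [].
    have alg (s t1 t2 v1 v2 : fps R) :
      (s * t1 * v1 + s * t2 * v2 = s * (v1 * t1 + v2 * t2))%R by ring.
    exact: alg.
  by rewrite fX => <-; rewrite -mulrA ac mulr1.
set r := (((divx X ∘ f) * q1 + (divy X ∘ f) * q2) * c)%R.
have XE' : X = ((psi : fps R) * r)%R by rewrite mulrA.
have [_ [_ irrX]] := smooth_irreducible (X00 aA) (smoothX aA).
have [|ru] := irrX psi r XE'; first by rewrite /ps_unit psi00 eqxx.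
have [u ur] := inv_ex (ru : (r : fps R) 0%N 0%N != 0%R).
exists u; last by rewrite XE' -mulrA ur mulr1.
apply/eqP => u0; have := congr1 (fun p : fps R => p 0%N 0%N) ur.
by rewrite /= fps_00M u0 mulr0 => /eqP; rewrite eq_sym oner_eq0.
Qed.

(** * The second invariant axis and the dichotomy *)

Local Notation nuD := (curveval X).

(** Exchanging the coordinates carries every result about the curve {Y = 0} over to {X = 0}. *)
Lemma autom_swap : autom (Y, X).
Proof.
have /automE[[c1 c2] d0] := aA; apply/automE; split; first by split.
by rewrite -oppr_eq0 /det opprB mulrC [X in (_ - X)%R]mulrC.
Qed.

Lemma swap_axis : [/\ valuation nuD, nuD X = +oo, nuD Y = 1 &
  forall nu, valuation nu -> nu X = +oo -> nu = nuD].
Proof.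
have aS := autom_swap; have [Q [aQ [QS SQ]]] := autom_inv aS; split.
- exact: (valuation_curveval aS aQ QS SQ).
- exact: (curveval_gen aS aQ SQ).
- exact: (curvevalX aS aQ QS SQ).
- exact: (val_eq_curveval aS aQ QS SQ).
Qed.

Lemma fixed_axes nu : fixed f nu -> nu = nuC \/ nu = nuD.
Proof.
move=> fnu; have [_ _ _ eqD] := swap_axis.
have [->|nuX] := fixed_cases fnu; [by left|right].
by apply: eqD => //; case: fnu.
Qed.

Lemma axes_neq : nuD <> nuC.
Proof.
have [_ nuDX _ _] := swap_axis => /(congr1 (fun nu => nu X)).
by rewrite nuDX (curvevalX aA aP PA AP).
Qed.

(* As X divides b, valuations close to nuD have c(f, nu) = nu(X) = nu(X o f):
   the limit of f_* nu takes the value 1 at X, whereas nuD(X) = +oo. *)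
Lemma contracted_axis_not_fixed q : b = (X * q)%R -> ~ fixed f nuD.
Proof.
have [vD nuDX nuDY eqD] := swap_axis; move=> bE [_ [_ [[cne _]|[_ lim]]]].
  apply: cne; rewrite (cfnE vD) nuDX nuDY bE (valM vD) nuDX.
  by rewrite min_l ?leey // addye ?addey // -ltNye (lt_le_trans _ (val_ge0 vD q)).
(* The set ]1, +oo] is a neighbourhood of nu_D(X) = +oo, and [nu0] is itself one of the valuations
   on which the limit is tested. *)
have [|nu0 [v0 [[le0 ne0] h]]] := lim X [set z | 1 < z].
  by rewrite nuDX; exists 1%R; split.
have := h nu0 v0 (fun p => lexx _) (conj le0 ne0); rewrite /=.
have [|s s0 e] := @val_fin _ nu0 X v0; first by move/(eqD _ v0).
have s1 : (1 <= s)%R by rewrite -lee_fin -e val_X_ge1.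
rewrite -[ccomp X f]/(X ∘ f) fX (valM v0) (val_unit v0 a0) adde0 (cfnE v0) e.
rewrite min_l /=; last first.
  rewrite bE (valM v0) e addeCA leeDl // adde_ge0 ?val_ge0 //.
by rewrite -EFinM divff ?ltxx // gt_eqF //; lra.
Qed.

(** Here c(f, nu_D) = 1 + nu_D(b) is finite, so the image is given by the plain formula; it is
    infinite at X, which characterizes nu_D. *)
Lemma fixed_axis : nuD b <> +oo -> fixed f nuD.
Proof.
have [vD nuDX nuDY eqD] := swap_axis; move=> bfin; split=> //.
have cne : cfn f nuD <> +oo.
  rewrite (cfnE vD) nuDX nuDY min_r ?leey //.
  by have [s _ ->] := val_fin vD bfin.
have [mu pm] := push_ex cf vD cne.
suff e : mu = nuD by move: pm; rewrite e.
apply: eqD; first by case: pm.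
have [c c1 ce] := cfn_fin cf vD cne.
rewrite (push_fin _ pm cne) -/(X ∘ f) fX (valM vD) (val_unit vD a0) adde0 nuDX ce.
by rewrite gt0_mulye // lte_fin invr_gt0 /=; lra.
Qed.

Lemma axis_not_eigenvaluation : ~ eigenvaluation f nuD.
Proof.
have [vD nuDX nuDY eqD] := swap_axis; move=> [_ [qm|[_ att]]].
  apply: (quasimonomial_fin (p := X) qm) => // X0.
  by have := smoothX aA; rewrite X0 !fps0E eqxx.
exact: (unit_axis_not_attracting autom_swap fX a0 att).
Qed.

Lemma contracted_axis_unique psi : contracted f psi -> curveval psi = nuD.
Proof.
move=> cpsi; have [u u0 e] := contracted_eq cpsi; rewrite e.
have X00 := X00 aA; have smX := smoothX aA.
apply: curveval_unit => //; first exact: mult_smooth.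
apply: mult_smooth; first by rewrite fps_00M X00 mul0r.
by rewrite fps_10M fps_01M X00 !mul0r !add0r !mulf_eq0 (negbTE u0) !orbF.
Qed.

Lemma axis_dichotomy :
  (case_i f nuC X /\ ~ (exists D, case_ii f nuC D)) \/
  (case_ii f nuC X /\ ~ (exists D, case_i f nuC D)).
Proof.
have [Q [aQ [QS SQ]]] := autom_inv autom_swap.
have mX : mult X = 1 by apply: mult_smooth (X00 aA) (smoothX aA).
have [boo|bfin] := pselect (nuD b = +oo).
  have [q bE] := curveval_eqoo autom_swap aQ QS SQ boo.
  have only nu : fixed f nu -> nu = nuC.
    by move=> fnu; case: (fixed_axes fnu) => // e; case: (contracted_axis_not_fixed bE); rewrite -e.
  left; split; last by move=> [D [_ [_ [fD [neD _]]]]]; apply: neD; apply: only.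
  split=> //; split; first exact: contracted_axis bE.
  by split=> //; apply: contracted_axis_unique.
have fD := fixed_axis bfin.
right; split; last by move=> [D [only _]]; apply: axes_neq; apply: only.
split; first exact: smooth_irreducible (X00 aA) (smoothX aA).
split=> //; split=> //; split; first exact: axes_neq.
exact: fixed_axes.
Qed.

Lemma eigenvaluation_unique nu : eigenvaluation f nu -> nu = nuC.
Proof.
move=> enu; case: (fixed_axes enu.1) => // e.
by case: axis_not_eigenvaluation; rewrite -e.
Qed.

End Dynamics.

Theorem theorem2 (R : realType) (f : germ R) :
  holo_germ f -> dominant f -> semi_superattracting f ->
  exists nus : ps R -> \bar R,
    eigenvaluation f nus /\
    (forall nu, eigenvaluation f nu -> nu = nus) /\
    exists psiC : ps R,
      ps_irreducible psiC /\ mult psiC = 1%E /\ nus = curveval psiC /\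
      exists psiD : ps R,
        intmult psiC psiD = 1%E /\
        ((case_i f nus psiD /\ ~ (exists D, case_ii f nus D)) \/
         (case_ii f nus psiD /\ ~ (exists D, case_i f nus D))).
Proof.
move=> [/inm1P f1 [/inm1P f2 _]] _ sf; have cf : centered f by [].
have [A [a [b [aA fX fY a0 b0]]]] := invariant_coordinates cf sf.
have [P [aP [PA AP]]] := autom_inv aA.
exists (curveval (snd_ A)); split.
  exact: (eigenvaluation_curve cf aA aP PA AP fX fY a0 b0).
split; first exact: (eigenvaluation_unique cf aA aP PA AP fX fY a0 b0).
exists (snd_ A); split; first exact: irreducibleY.
split; first exact: multY.
split=> //; exists (fst_ A); split; first exact: (intmultXY aA aP PA AP).
exact: (axis_dichotomy cf aA aP PA AP fX fY a0 b0).
Qed.
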